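(* Let $\mathbb{T}$ be a family of admissible triangulations with property (A2): there are finitely many reference patches $\mathcal{C}_1,\dots,\mathcal{C}_J$ of the vertex $0$ such that for all $\mathcal{T}\in\mathbb{T}$ and all vertices $z$ of $\mathcal{T}$ the set $\mathcal{T}(z)$ of simplices with vertex $z$ satisfies $\mathcal{T}(z)=z+h\,\mathcal{C}_j$ for some $h>0$ and some $j\in\{1,\dots,J\}$, where $h\,\mathcal{C}_j=\{hK:K\in\mathcal{C}_j\}$. Let $\mathcal{T}\in\mathbb{T}$, let $\widehat{\mathcal{T}}\in\mathbb{T}$ be an admissible refinement of $\mathcal{T}$, and let $u_h\in V(\mathcal{T})$ be the discrete solution. With the operators $I_h$, $\widehat{I}_h$, $J_2$ and $J_{2,T}$ from the context, set $\widehat{u}_h^*:=\widehat{I}_hJ_2u_h\in V(\widehat{\mathcal{T}})$. Suppose (C3) $(\widehat{v}_h-I_h\widehat{v}_h)|_T=0$ for all $T\in\mathcal{T}\cap\widehat{\mathcal{T}}$ and all $\widehat{v}_h\in V(\widehat{\mathcal{T}})$; (C4) $I_h\widehat{u}_h^*=u_h$; (C5) there is a constant $\Lambda_5$ with $\Vert D^m_{\mathrm{NC}}(\widehat{I}_hv-w_h)\Vert_{L^2(T)}\le\Lambda_5\Vert D^m_{\mathrm{NC}}(v-w_h)\Vert_{L^2(T)}$ for all $T\in\mathcal{T}$, $v\in H^m_0(\Omega)$ and $w_h\in V(\mathcal{T})$; (C6) for every $\mathcal{T}\in\mathbb{T}$, $w_h|_T=J_{2,T}(w_h)$ on $T$ for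 all $T\in\mathcal{T}$ and all $w_h\in(V(\mathcal{T})\cap H^m_0(\Omega))|_{\Omega(T)}$; (C7) for every $\mathcal{T}\in\mathbb{T}$, every $T\in\mathcal{T}$ and every $w_h\in V(\mathcal{T})|_{\Omega(T)}$: if $\mu_T(w_h)=0$, then $w_h\in(V(\mathcal{T})\cap H^m_0(\Omega))|_{\Omega(T)}$. Then $$\Vert\widehat{u}_h^*-u_h\Vert_h^2\le\Lambda_2^2\sum_{T\in\mathcal{R}}h_T\sum_{F\in\mathcal{F}(T)}\Vert[D^m_{\mathrm{NC}}u_h]_F\times\nu_F\Vert_{L^2(F)}^2\qquad\text{with }\Lambda_2=\Lambda_5\,C(\mathbb{T})\,M_3^{1/2},$$ where $\mathcal{R}:=\{K\in\mathcal{T}:\ \exists\,T\in\mathcal{T}\setminus\widehat{\mathcal{T}}\text{ with }\mathrm{dist}(K,T)=0\}$ and where $C(\mathbb{T})<\infty$ is the finite constant from the context, i.e. $\varrho_T(w_h)\le C(\mathbb{T})\,\mu_T(w_h)$ for all $T\in\mathcal{T}\in\mathbb{T}$ and all $w_h\in V(\mathcal{T})|_{\Omega(T)}$.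
   Context: $\Omega\subset\mathbb{R}^n$ is a bounded polyhedral Lipschitz domain; $\mathbb{T}$ is the set of regular triangulations (into closed simplices, in the sense of Ciarlet) obtained from an initial triangulation by successive admissible refinements. For $\mathcal{T}\in\mathbb{T}$: $\mathcal{F}(T)$ is the set of sides ($(n-1)$-dimensional faces) of $T$, $\mathcal{T}(z)$ the set of simplices with vertex $z$, $h_T=\mathrm{diam}(T)$, $h_F=\mathrm{diam}(F)$. Property (A2) implies uniform shape regularity of $\mathbb{T}$. For $T\in\mathcal{T}$ let $\mathcal{T}(\Omega(T)):=\{K\in\mathcal{T}:\mathrm{dist}(T,K)=0\}$, let $\Omega(T)$ be the interior of its union, and $M_3:=\sup_{T\in\mathcal{T}\in\mathbb{T}}|\mathcal{T}(\Omega(T))|<\infty$. $\mathcal{F}(\Omega(T))$ is the set of all sides $F=\partial K_1\cap\partial K_2$ for distinct neighbouring $K_1,K_2\in\mathcal{T}(\Omega(T))$ plus all boundary sides $F\subseteq\partial\Omega$ with $F\in\mathcal{F}(K)$ for some $K\in\mathcal{T}(\Omega(T))$. Every side $F$ has a unit normal $\nu_F$ of fixed orientation (outward on $\partial\Omega$). The jump $[v]_F$ is the difference $v|_{T_+}-v|_{T_-}$ of the two traces on an interior side $F=\partial T_+\cap\partial T_-$ and $[v]_F=v$ on a boundary side. $[\,\cdot\,]_F\times\nu_F$ denotes the tangential components of the jump along $F$. $m\ge1$ and $k$ are integers, $V(\mathcal{T})\subset P_k(\mathcal{T})$ is a vector space of $\mathcal{T}$-piecewise polynomials of degree at most $k$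 (one for each $\mathcal{T}\in\mathbb{T}$). $D^m_{\mathrm{NC}}$ is the piecewise $m$-th derivative, $a_h(v,w)=(D^m_{\mathrm{NC}}v,D^m_{\mathrm{NC}}w)_{L^2(\Omega)}$ is a scalar product on $V(\mathcal{T})+V(\widehat{\mathcal{T}})$ with induced norm $\Vert v\Vert_h=\Vert D^m_{\mathrm{NC}}v\Vert_{L^2(\Omega)}$. The discrete solution $u_h\in V(\mathcal{T})$ satisfies $a_h(u_h,v_h)=\int_\Omega fv_h\,\mathrm{d}x$ for all $v_h\in V(\mathcal{T})$ for a given $f\in L^2(\Omega)$. $I_h:H^m_0(\Omega)+V(\widehat{\mathcal{T}})\to V(\mathcal{T})$ and $\widehat{I}_h:H^m_0(\Omega)\to V(\widehat{\mathcal{T}})$ are linear interpolation operators, $V_C(\mathcal{T})\subset H^m_0(\Omega)$ is a finite-dimensional conforming space and $J_2:V(\mathcal{T})\to V_C(\mathcal{T})$ is a linear operator that is local in the sense that for each $T\in\mathcal{T}$ there is a linear operator $J_{2,T}$ on $V(\mathcal{T})|_{\Omega(T)}:=\{v_h|_{\Omega(T)}:v_h\in V(\mathcal{T})\}$ with $(J_2v_h)|_T=J_{2,T}(v_h|_{\Omega(T)})$ for all $v_h\in V(\mathcal{T})$. Also $(V(\mathcal{T})\cap H^m_0(\Omega))|_{\Omega(T)}:=\{v|_{\Omega(T)}:v\in V(\mathcal{T})\cap H^m_0(\Omega)\}$. For $w_h\in V(\mathcal{T})|_{\Omega(T)}$ define the seminorms $$\mu_T(w_h):=\Big(\sum_{F\in\mathcal{F}(\Omega(T))}h_F\Vert[D^m_{\mathrm{NC}}w_h]_F\times\nu_F\Vert_{L^2(F)}^2\Big)^{1/2},\qquad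 \varrho_T(w_h):=\Vert D^m(w_h-J_{2,T}w_h)\Vert_{L^2(T)}.$$ By (C6), (C7) and finite dimension there is a constant $C(T)$ with $\varrho_T(w_h)\le C(T)\mu_T(w_h)$ for all $w_h\in V(\mathcal{T})|_{\Omega(T)}$. Under (A2), (C6) and (C7) these constants are uniformly bounded, i.e. $C(\mathbb{T}):=\sup_{T\in\mathcal{T}\in\mathbb{T}}C(T)<\infty$; this defines the finite constant $C(\mathbb{T})$, which depends exclusively on $\mathbb{T}$ and the maximal polynomial degree $k$. *)

(* Defs.v *)
From HB Require Import structures.
From Stdlib Require Import Relation_Operators.
From mathcomp Require Import all_boot all_order all_algebra finmap.
From mathcomp Require mpoly.
From mathcomp Require Import all_classical all_reals all_analysis.

Set Implicit Arguments.
Unset Strict Implicit.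
Unset Printing Implicit Defensive.

Import Order.TTheory GRing.Theory Num.Theory.
Import numFieldNormedType.Exports.

Local Open Scope classical_set_scope.
Local Open Scope ring_scope.

(* The space dimension is n.+1, so points have type 'rV[R]_n.+1 and a side of a
   simplex is n-dimensional. *)

Section measurable_rV.
Context {R : realType} {n : nat}.
Let coord (i : 'I_n) (x : 'rV[R]_n) : measurableTypeR R := x ord0 i.
Let rV0 : g_sigma_preimage coord set0.
Proof. exact: sigma_algebra0. Qed.
Let rVC A : g_sigma_preimage coord A -> g_sigma_preimage coord (~` A).
Proof. exact: sigma_algebraC. Qed.
Let rVU (F : (set 'rV[R]_n)^nat) : (forall i, g_sigma_preimage coord (F i)) ->
  g_sigma_preimage coord (\bigcup_i (F i)).
Proof. exact: sigma_algebra_bigcup. Qed.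
Fact rV_display : measure_display. Proof. exact: default_measure_display. Qed.
HB.instance Definition _ := @isMeasurable.Build rV_display
  'rV[R]_n (g_sigma_preimage coord) rV0 rVC rVU.
End measurable_rV.

Section measurable_rV_theory.
Context {R : realType} {n : nat}.

Lemma measurable_rV_coord (i : 'I_n) :
  measurable_fun [set: 'rV[R]_n]
    (fun x : 'rV[R]_n => x ord0 i : measurableTypeR R).
Proof.
move=> _ Y mY; rewrite setTI; apply: sub_sigma_algebra => /=.
rewrite -bigcup_seq/=; exists i => /=; first by rewrite mem_index_enum.
by exists Y => //; rewrite setTI.
Qed.

Lemma measurable_fun_rV d (T : measurableType d) (f : T -> 'rV[R]_n) :
  (forall i, measurable_fun [set: T]
     (fun t => f t ord0 i : measurableTypeR R)) ->
  measurable_fun [set: T] f.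
Proof.
move=> mf; have sub : (\big[setU/set0]_(i < n) preimage_set_system setT
    (fun x : 'rV[R]_n => x ord0 i : measurableTypeR R) measurable) `<=`
    [set A | measurable (f @^-1` A)].
  rewrite -bigcup_seq => A [i _] [B mB <-].
  by rewrite setTI /= -[X in measurable X]setTI; exact: mf.
move=> _ A mA; rewrite setTI.
suff : [set B | measurable (f @^-1` B)] A by [].
apply: mA; split=> //; split=> [|B mB|F mF] /=.
- by rewrite preimage_set0; exact: measurable0.
- by rewrite setTD preimage_setC; exact: measurableC.
- by rewrite preimage_bigcup; exact: bigcupT_measurable.
Qed.

End measurable_rV_theory.

(* Lebesgue measure on R^n, as the n-fold product of the one-dimensional one. *)
Section lebesgue_rV.
Context {R : realType}.
Local Notation RB := (measurableTypeR R).

Definition cons_rV n (p : RB * 'rV[R]_n) : 'rV[R]_n.+1 :=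
  row_mx (p.1)%:M p.2.

Definition uncons_rV n (x : 'rV[R]_n.+1) : RB * 'rV[R]_n :=
  (x ord0 ord0, rsubmx (x : 'rV_(1 + n))).

Lemma cons_rVK n : cancel (@cons_rV n) (@uncons_rV n).
Proof.
move=> [a v]; rewrite /uncons_rV /cons_rV/= row_mxKr; congr pair.
rewrite mxE; case: (split_ordP (ord0 : 'I_(1 + n))) => j /(congr1 val)//= _.
by rewrite (ord1 j) mxE.
Qed.

Lemma measurable_cons_rV n : measurable_fun setT (@cons_rV n).
Proof.
apply: measurable_fun_rV => i; rewrite /cons_rV.
have [j ->|j ->] := split_ordP (i : 'I_(1 + n)).
  rewrite (_ : (fun _ => _) = fst); first exact: measurable_fst.
  by apply/funext => -[a v]; apply: etrans (row_mxEl _ _ _ _) _; rewrite (ord1 j) mxE.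
rewrite (_ : (fun _ => _) = (fun x : 'rV[R]_n => x ord0 j : RB) \o snd).
  by apply: measurableT_comp; [exact: measurable_rV_coord|exact: measurable_snd].
by apply/funext => -[a v]; exact: row_mxEr.
Qed.

Lemma measurable_uncons_rV n : measurable_fun setT (@uncons_rV n).
Proof.
apply/measurable_fun_pair; first exact: measurable_rV_coord.
apply: measurable_fun_rV => i /=.
rewrite (_ : (fun _ => _) = fun x : 'rV[R]_n.+1 => x ord0 (rshift 1 i) : RB).
  exact: measurable_rV_coord.
by apply/funext => x; rewrite mxE.
Qed.

Section step.
Context {n : nat} (mu : {sigma_finite_measure set 'rV[R]_n -> \bar R}).

Definition lebesgue_rV_step : set 'rV[R]_n.+1 -> \bar R :=
  pushforward (lebesgue_measure \x mu)%E (@cons_rV n).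

Let step_pushforward : {measure set 'rV[R]_n.+1 -> \bar R} :=
  measure_function_pushforward__canonical__measure_function_Measure
    (lebesgue_measure \x mu)%E (@measurable_cons_rV n).

Let step0 : lebesgue_rV_step set0 = 0%E.
Proof. exact: (measure0 step_pushforward). Qed.

Let step_ge0 A : (0 <= lebesgue_rV_step A)%E.
Proof. exact: (measure_ge0 step_pushforward). Qed.

Let step_sigma_additive : semi_sigma_additive lebesgue_rV_step.
Proof. exact: (@measure_semi_sigma_additive _ _ _ step_pushforward). Qed.

HB.instance Definition _ := isMeasure.Build _ _ _ lebesgue_rV_step
  step0 step_ge0 step_sigma_additive.

Let step_sigma_finite : sigma_finite setT lebesgue_rV_step.
Proof.
have /sigma_finiteP[F [TF ndF Foo]] :=
  sigma_finiteT (lebesgue_measure : {sigma_finite_measure set RB -> \bar R}).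
have /sigma_finiteP[G [TG ndG Goo]] := sigma_finiteT mu.
exists (fun k => @uncons_rV n @^-1` (F k `*` G k)) => [|k].
  rewrite -preimage_bigcup -[LHS](preimage_setT (@uncons_rV n)); congr (_ @^-1` _).
  rewrite -setXTT TF TG predeqE => -[x y]; split.
    move=> [/= [i _ Fix] [j _ Gjy]]; exists (maxn i j) => //; split.
    - by apply: subsetPset (ndF _ _ (leq_maxl i j)) _ Fix.
    - by apply: subsetPset (ndG _ _ (leq_maxr i j)) _ Gjy.
  by move=> [i _ []/= ? ?]; split; exists i.
have [mF Fk] := Foo k; have [mG Gk] := Goo k; split.
  rewrite -[X in measurable X]setTI.
  by apply: measurable_uncons_rV => //; exact: measurableX.
rewrite /lebesgue_rV_step /pushforward -comp_preimage (_ : _ \o _ = id).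
  by rewrite preimage_id product_measure1E// lte_mul_pinfty// ge0_fin_numE.
by apply/funext => p /=; exact: cons_rVK.
Qed.

HB.instance Definition _ := Measure_isSigmaFinite.Build _ _ _ lebesgue_rV_step
  step_sigma_finite.

End step.

Fixpoint lebesgue_rV n : {sigma_finite_measure set 'rV[R]_n -> \bar R} :=
  if n is n'.+1 then lebesgue_rV_step (lebesgue_rV n') else \d_(0 : 'rV[R]_0).
End lebesgue_rV.

Section geometry.
Context {R : realType} {n : nat}.
Local Notation E := 'rV[R]_n.+1.

Definition dot (x y : E) : R := \sum_i x ord0 i * y ord0 i.

(* The library norm on 'rV is the maximum norm. *)
Definition enorm (x : E) : R := Num.sqrt (dot x x).

Definition diam (A : set E) : R := sup [set enorm (x - y) | x in A & y in A].

Definition dist (A B : set E) : R := inf [set enorm (x - y) | x in A & y in B].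

Definition bdry (A : set E) : set E := closure A `\` A°.

(* Near a boundary point, Om is the part above the graph of a Lipschitz function
   over the hyperplane orthogonal to e. *)
Definition lipschitz_boundary (Om : set E) :=
  forall z, bdry Om z -> exists (U : set E) (e : E) (g : E -> R),
    [/\ nbhs z U, enorm e = 1,
        exists L, forall x y, `|g x - g y| <= L * enorm (x - y)
      & forall y, U y ->
          (Om y <-> g (y - dot y e *: e) < dot y e)].

(* A simplex, or a side of one, is represented by its set of vertices, and the
   point set it stands for is the convex hull of these. *)
Definition simplex := {fset E}.

Definition mesh := {fset simplex}.

Definition hull (K : simplex) : set E :=
  [set x | exists a : E -> R, [/\ {in K, forall v, 0 <= a v},
     \sum_(v <- K) a v = 1 & x = \sum_(v <- K) a v *: v]].

Definition affinely_independent (K : simplex) := forall a : E -> R,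
  \sum_(v <- K) a v = 0 -> \sum_(v <- K) a v *: v = 0 ->
  {in K, forall v, a v = 0}.

Definition nsimplex (K : simplex) := #|` K| = n.+2 /\ affinely_independent K.

Definition polyhedral (Om : set E) := exists P : mesh,
  {in P, forall K, nsimplex K} /\ closure Om = \bigcup_(K in [set` P]) hull K.

Definition polyhedral_lipschitz_domain (Om : set E) :=
  [/\ Om !=set0, open Om, connected Om, bounded_set Om
    & polyhedral Om /\ lipschitz_boundary Om].

(* Two elements meet in the face spanned by their common vertices, which is empty
   if there are none. *)
Definition triangulation (Om : set E) (T : mesh) :=
  [/\ {in T, forall K, nsimplex K},
      closure Om = \bigcup_(K in [set` T]) hull K
    & {in T &, forall K L, hull K `&` hull L = hull (K `&` L)%fset}].

Definition refines (T' T : mesh) :=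
  {in T', forall K', exists2 K, K \in T & hull K' `<=` hull K}.

(* The meshes that arise from T by finitely many steps of the one-step
   refinement rule adm. *)
Definition refinements (adm : mesh -> mesh -> Prop) (T : mesh) : set mesh :=
  [set T' | clos_refl_trans mesh adm T T'].

Definition vertex_patch (T : mesh) (z : E) : mesh := [fset K in T | z \in K]%fset.

Definition finitely_many_patches (TT : set mesh) :=
  exists (J : nat) (C : 'I_J -> mesh),
    (forall j, {in C j, forall K, nsimplex K /\ 0 \in K}) /\
    forall T z, TT T -> (exists2 K, K \in T & z \in K) ->
      exists (h : R) (j : 'I_J), 0 < h /\
        vertex_patch T z = [fset [fset (z + h *: x)%R | x in (K : simplex)] | K in C j]%fset.

Definition sides (K : simplex) : {fset simplex} := [fset (K `\ v)%fset | v in K]%fset.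

Definition patch_of (T : mesh) (K : simplex) : mesh :=
  [fset L in T | dist (hull K) (hull L) == 0]%fset.

Definition patch_domain (T : mesh) (K : simplex) : set E :=
  (\bigcup_(L in [set` patch_of T K]) hull L)°.

Definition is_patch_side (Om : set E) (T : mesh) (K F : simplex) :=
  hull F `<=` bdry Om \/
  exists K1 K2, [/\ K1 \in patch_of T K, K2 \in patch_of T K, K1 != K2,
                    F \in sides K1 & F \in sides K2].

Definition patch_sides (Om : set E) (T : mesh) (K : simplex) : {fset simplex} :=
  [fset F in (\bigcup_(L <- patch_of T K) sides L)%fset
     | `[< is_patch_side Om T K F >]]%fset.

(* [sup] of a set without upper bound is 0, but under [finitely_many_patches] the
   patches of the triangulations in TT have a common bound. *)
Definition max_patch_card (TT : set mesh) : R :=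
  sup [set x | exists T K, [/\ TT T, K \in T & x = (#|` patch_of T K|)%:R]].

Definition refined_nbhd (T T' : mesh) : mesh :=
  [fset K in T | `[< exists2 L, L \in (T `\` T')%fset
                              & dist (hull K) (hull L) = 0 >]]%fset.

Definition unit_normal (F : simplex) (nu : E) :=
  enorm nu = 1 /\ {in F &, forall x y, dot nu (x - y) = 0}.

Definition points_out (K F : simplex) (nu : E) :=
  forall x y, hull F x -> (hull K)° y -> dot nu (y - x) < 0.

Definition side_orientation (Om : set E) (TT : set mesh) (nu : simplex -> E) :=
  forall T K F, TT T -> K \in T -> F \in sides K ->
    unit_normal F (nu F) /\ (hull F `<=` bdry Om -> points_out K F (nu F)).

End geometry.
Arguments simplex : clear implicits.
Arguments mesh : clear implicits.

Section function_spaces.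
Context {R : realType} {n : nat}.
Local Notation E := 'rV[R]_n.+1.
Local Notation leb := (lebesgue_rV n.+1).

(* A multi-derivative is indexed by the sequence of its directions, and the
   tensor D^m v by the n.+1 ^ m sequences of length m. *)
Definition partials (s : seq 'I_n.+1) (f : E -> R) : E -> R :=
  foldr (fun i g x => 'D_(delta_mx ord0 i) g x) f s.

(* For an element K the space L^2(K) is L^2 of the interior of K, as the boundary
   is a null set. *)
Definition L2norm (D : set E) (m : nat) (G : seq 'I_n.+1 -> E -> R) : R :=
  Num.sqrt (\int[leb]_(x in D) \sum_(t : m.-tuple 'I_n.+1) G t x ^+ 2).

Definition L2fun (D : set E) : set (E -> R) :=
  [set f : E -> R | measurable_fun D f /\ leb.-integrable D (fun x => (f x ^+ 2)%:E)].

Definition smooth (f : E -> R) := forall s : seq 'I_n.+1,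
  continuous (partials s f) /\
  forall x i, derivable (partials s f) x (delta_mx ord0 i).

Definition test_fun (U : set E) : set (E -> R) :=
  [set f : E -> R | smooth f /\
     exists K : set E, [/\ compact K, K `<=` U & forall x, ~ K x -> f x = 0]].

Definition weak_derivative (U : set E) (s : seq 'I_n.+1) (f g : E -> R) :=
  L2fun U g /\ forall phi, test_fun U phi ->
    \int[leb]_(x in U) (f x * partials s phi x) =
    (-1) ^+ size s * \int[leb]_(x in U) (g x * phi x).

(* A representative of the weak derivative, which is unique up to null sets. *)
Definition wderiv (U : set E) (s : seq 'I_n.+1) (f : E -> R) : E -> R :=
  xget (fun=> 0) [set g | weak_derivative U s f g].

(* Elements of H^m_0 are functions, and two of them are the same element if they
   are equal almost everywhere in Om. *)
Definition H0 (m : nat) (Om : set E) : set (E -> R) :=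
  [set v : E -> R | L2fun Om v /\ exists g : seq 'I_n.+1 -> E -> R,
     (forall s, (size s <= m)%N -> weak_derivative Om s v (g s)) /\
     forall eps, 0 < eps -> exists2 phi, test_fun Om phi &
       forall j, (j <= m)%N -> L2norm Om j (fun s => g s - partials s phi) < eps].

Definition mesh_interior (T : mesh R n) : set E :=
  \bigcup_(K in [set` T]) (hull K)°.

(* A piecewise polynomial is defined up to its values on the null set of the
   element boundaries.  It is represented by the function that vanishes there
   and outside of the mesh, so that equality is equality of functions. *)
Definition piecewise_poly (k : nat) (T : mesh R n) : set (E -> R) :=
  [set f : E -> R | (forall x, ~ mesh_interior T x -> f x = 0) /\
     {in T, forall K, exists2 p : mpoly.mpoly n.+1 R,
        (forall a, mpoly.mcoeff a p != 0 -> (mpoly.mdeg a <= k)%N) &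
        forall x, (hull K)° x -> f x = mpoly.meval (fun i => x ord0 i) p}].

Definition Dnc (T : mesh R n) (s : seq 'I_n.+1) (v : E -> R) : E -> R :=
  partials s v \_ (mesh_interior T).

Definition a_h (Om : set E) (m : nat) (T : mesh R n) (v w : E -> R) : R :=
  \int[leb]_(x in Om) \sum_(t : m.-tuple 'I_n.+1) Dnc T t v x * Dnc T t w x.

Definition norm_h (Om : set E) (m : nat) (T : mesh R n) (v : E -> R) : R :=
  L2norm Om m (fun s => Dnc T s v).

Definition linear_subspace (W : set (E -> R)) :=
  W 0 /\ forall (a : R) u v, W u -> W v -> W (a *: u + v).

Definition fin_dim (D : set E) (W : set (E -> R)) :=
  exists (N : nat) (b : 'I_N -> E -> R), forall v, W v ->
    exists c : 'I_N -> R, v = \sum_i c i *: b i %[ae leb in D].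

Definition sum_space (W W' : set (E -> R)) : set (E -> R) :=
  [set u + v | u in W & v in W'].

Definition restriction (D : set E) (W : set (E -> R)) : set (E -> R) :=
  [set v \_ D | v in W].

(* Linear operators between spaces of functions up to equality almost everywhere
   in D and in D', respectively. *)
Definition linear_operator (D D' : set E) (dom cod : set (E -> R))
    (L : (E -> R) -> (E -> R)) :=
  [/\ forall v, dom v -> cod (L v),
      forall (a : R) u v, dom u -> dom v ->
        L (a *: u + v) = a *: L u + L v %[ae leb in D']
    & forall u v, dom u -> dom v -> u = v %[ae leb in D] ->
        L u = L v %[ae leb in D']].

Definition scalar_product (D : set E) (W : set (E -> R))
    (a : (E -> R) -> (E -> R) -> R) :=
  [/\ forall u v, W u -> W v -> a u v = a v u,
      forall (c : R) u v w, W u -> W v -> W w ->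
        a (c *: u + v) w = c * a u w + a v w,
      forall v, W v -> 0 <= a v v
    & forall v, W v -> a v v = 0 -> v = 0 %[ae leb in D]].

End function_spaces.

Section sides.
Context {R : realType} {n : nat}.
Local Notation E := 'rV[R]_n.+1.

(* The surface integral over a side F, from the affine parametrization of F over
   the reference simplex with the square root of the Gram determinant of the
   edges as area element.  The value does not depend on the order in which F
   enumerates its vertices. *)
Definition side_edge (F : simplex R n) (i : 'I_n) : E :=
  nth 0 F i.+1 - nth 0 F 0.

Definition side_gram (F : simplex R n) : 'M[R]_n :=
  \matrix_(i, j) dot (side_edge F i) (side_edge F j).

Definition reference_simplex : set 'rV[R]_n :=
  [set s | (forall i, 0 <= s ord0 i) /\ \sum_i s ord0 i <= 1].

Definition side_integral (F : simplex R n) (g : E -> R) : R :=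
  Num.sqrt (\det (side_gram F)) *
  \int[lebesgue_rV n]_(s in reference_simplex)
    g (nth 0 F 0 + \sum_i s ord0 i *: side_edge F i).

Definition trace_from (K : simplex R n) (g : E -> R) (x : E) : R :=
  lim (g y @[y --> within (hull K)° (nbhs x)]).

(* T_+ is the element from which nu points outward; on a boundary side, where
   nu is the outer normal, only the trace from T_+ occurs. *)
Definition jump (T : mesh R n) (F : simplex R n) (nu : E) (g : E -> R) (x : E) : R :=
  \sum_(K <- T | F \in sides K)
    (if `[< points_out K F nu >] then 1 else -1) * trace_from K g x.

(* The L^2(F) norm of [D^m v]_F x nu.  The tangential components of a vector j are those
   of j - (j . nu) nu; for a tensor they are taken row by row. *)
Definition tangential_jump_norm (m : nat) (T : mesh R n) (F : simplex R n)
    (nu : E) (v : E -> R) : R :=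
  let J s := jump T F nu (Dnc T s v) in
  Num.sqrt (side_integral F (fun x =>
    \sum_(t : m.-1.-tuple 'I_n.+1) \sum_i
      (J (i :: t) x - (\sum_j J (j :: t) x * nu ord0 j) * nu ord0 i) ^+ 2)).

Definition mu_loc (Om : set E) (nu : simplex R n -> E) (m : nat)
    (T : mesh R n) (K : simplex R n) (w : E -> R) : R :=
  Num.sqrt (\sum_(F <- patch_sides Om T K)
    diam (hull F) * tangential_jump_norm m T F (nu F) w ^+ 2).

(* For v in H^m_0 and w in V(T), the piecewise derivative of v - w and of w - v is
   split by linearity: the weak derivative of v in the interior of an element,
   and the classical one of the piecewise polynomial w. *)
Definition Hm_error (m : nat) (T : mesh R n) (K : simplex R n) (v w : E -> R) : R :=
  L2norm (hull K)° m (fun s => wderiv (hull K)° s v - Dnc T s w).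

Definition rho_loc (m : nat) (J2K : (E -> R) -> (E -> R))
    (T : mesh R n) (K : simplex R n) (w : E -> R) : R :=
  L2norm (hull K)° m (fun s => Dnc T s w - wderiv (hull K)° s (J2K w)).

End sides.

(* Main.v *)
Require Import Defs.
From Stdlib Require Import Relation_Operators Operators_Properties.
From mathcomp Require Import all_boot all_order all_algebra finmap.
From mathcomp Require mpoly.
From mathcomp Require Import all_classical all_reals all_analysis.
From mathcomp Require Import measurable_realfun ring lra.

(** The discrete error e = uhat - u is compared with u element by element.  The
    elements of That refine those of T, so the squared energy norm of e is at most
    the sum of its contributions from the elements K of T
    ([integral_mesh_interior_le]).  If K belongs to That as well, e vanishes on K
    by (C3) and (C4).  Otherwise (C5) bounds the contribution of K by a multiple of
    the distance between D^m u and D^m (J2 u) on K.  This distance only depends on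
    the restriction of u to the patch of K, since classical derivatives of u, weak
    derivatives of J2 u ([wderiv_ae]) and J2 itself are local; so it is rho_K, and
    hence at most CT times the jumps of u over the sides in the patch of K.

    The seminorm mu_K has to be evaluated at the restriction of u to the patch,
    extended by zero, whereas the jump over a side F collects the traces from all
    elements of T with side F.  Both agree once every element with a side F of the
    patch lies in the patch itself ([patch_side_elements]).  This is where the
    geometry of the triangulation enters: two distinct elements with a common side
    lie on opposite sides of its hyperplane ([opposite_sides]), so at most two
    elements share a side, and only one if the side is on the boundary, where the
    orientation of the normal makes all the elements lie on the same side.

    It remains to sum over the refined elements K.  The jumps over the sides of
    the patch of K are bounded by those over the sides of the elements L of the
    patch, and each L in the neighbourhood of the refined region is counted once for
    every refined K at distance zero from L, that is, at most M3 times
    ([sum_patches_le]).  The supremum M3 is an upper bound because, by compactness of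
    simplices, elements at distance zero share a vertex ([meet_shared_vertex]), and
    (A2) bounds the number of elements at a vertex ([card_patch_le_max]). *)

Set Implicit Arguments.
Unset Strict Implicit.
Unset Printing Implicit Defensive.

Import Order.TTheory GRing.Theory Num.Theory.
Import numFieldNormedType.Exports.

Local Open Scope classical_set_scope.
Local Open Scope ring_scope.

(** * Integrals of functions equal almost everywhere *)

Section ae_integral.
Context d (T : measurableType d) (R : realType) (mu : {measure set T -> \bar R}).
Local Open Scope ereal_scope.
Import HBNNSimple.

(** The integral is a supremum over simple functions, and cutting a simple function
    off on a measurable null set does not change its integral.  So the integral of
    an arbitrary nonnegative function is insensitive to null sets.  This generality
    matters for weak derivatives, where J2 u is integrated over elements whose
    interiors may leave the set on which it is known to be measurable. *)
Lemma ge0_ae_le_integralT (f g : T -> \bar R) :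
  (forall x, 0 <= f x) -> (forall x, 0 <= g x) ->
  {ae mu, forall x, f x = g x} -> \int[mu]_x f x <= \int[mu]_x g x.
Proof.
move=> f0 g0 [N [mN N0 subN]].
rewrite ge0_integralTE// ge0_integralTE//; apply: ge_ereal_sup => _ [h /= hf <-].
have mNC : measurable (~` N) by exact: measurableC.
apply: le_ereal_sup_tmp; exists (sintegral mu (proj_nnsfun h mNC)).
  exists (proj_nnsfun h mNC) => //= x.
  rewrite /= mindicE; have [xN|xN] := pselect (N x).
    by rewrite memNset ?mulr0//; apply.
  rewrite mem_set// mulr1 (le_trans (hf x))//.
  by have -> : f x = g x by apply: contrapT => ne; apply/xN/subN.
rewrite -!integralT_nnsfun.
rewrite (@ge0_negligible_integral _ _ _ mu setT N)//; last 2 first.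
- by apply/measurable_EFinP.
- by move=> x _; rewrite lee_fin.
rewrite [leRHS](@ge0_negligible_integral _ _ _ mu setT N)//; last 2 first.
- by apply/measurable_EFinP.
- by move=> x _; rewrite lee_fin.
rewrite le_eqVlt; apply/orP; left; apply/eqP; apply: eq_integral => x.
by rewrite inE => -[_ xN] /=; rewrite mindicE mem_set//= mulr1.
Qed.

Lemma ge0_ae_eq_integralT (f g : T -> \bar R) :
  (forall x, 0 <= f x) -> (forall x, 0 <= g x) ->
  {ae mu, forall x, f x = g x} -> \int[mu]_x f x = \int[mu]_x g x.
Proof.
move=> f0 g0 fg; apply/eqP; rewrite eq_le !ge0_ae_le_integralT//.
by apply: filterS fg.
Qed.

Lemma integral_ae_eq (D : set T) (f g : T -> \bar R) :
  ae_eq mu D f g -> \int[mu]_(x in D) f x = \int[mu]_(x in D) g x.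
Proof.
move=> fg; rewrite integral_mkcond [RHS]integral_mkcond.
have fgT : {ae mu, forall x, (f \_ D) x = (g \_ D) x}.
  apply: filterS fg => x Dx; rewrite !patchE; case: ifPn => // /set_mem.
  exact: Dx.
rewrite integralE [RHS]integralE; congr (_ - _); apply: ge0_ae_eq_integralT => //;
  by apply: filterS fgT => x; rewrite ?funeposE ?funenegE => ->.
Qed.
End ae_integral.

Lemma Rintegral_ae_eq d (T : measurableType d) (R : realType)
  (mu : {measure set T -> \bar R}) (D : set T) (f g : T -> R) :
  ae_eq mu D f g -> \int[mu]_(x in D) f x = \int[mu]_(x in D) g x.
Proof.
by move=> fg; congr fine; apply: integral_ae_eq; apply: filterS fg => x /[apply] ->.
Qed.

(** * Polynomial functions and their derivatives *)

Lemma ler_coord {R : realType} n (x : 'rV[R]_n) i : `|x ord0 i| <= `|x|.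
Proof.
have /mapP[j _ ->] : `|x ord0 i| \in [seq `|x ij.1 ij.2| | ij : 'I_1 * 'I_n].
  by apply/mapP; exists (ord0, i) => //=; rewrite mem_enum.
by rewrite [leRHS]/Num.norm /= mx_normrE; apply/bigmax_geP; right => /=; exists j.
Qed.

Section polynomial.
Context {R : realType} {n : nat}.
Local Notation E := 'rV[R]_n.

(** Polynomial functions as a closure of constants and coordinates: the properties
    used of the elements of V(T) all follow by induction on this description. *)
Inductive polyfun : (E -> R) -> Prop :=
| polyfun_cst c : polyfun (fun=> c)
| polyfun_coord i : polyfun (fun x => x ord0 i)
| polyfunD f g : polyfun f -> polyfun g -> polyfun (f + g)
| polyfunM f g : polyfun f -> polyfun g -> polyfun (f * g).

Lemma polyfunB f g : polyfun f -> polyfun g -> polyfun (f - g).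
Proof.
move=> pf pg; have -> : f - g = f + (fun=> -1) * g.
  by apply/funext => x; rewrite !fctE mulN1r.
by apply: polyfunD => //; apply: polyfunM => //; exact: polyfun_cst.
Qed.

Lemma polyfun_sum (I : Type) (r : seq I) (P : pred I) (F : I -> E -> R) :
  (forall i, P i -> polyfun (F i)) -> polyfun (fun x => \sum_(i <- r | P i) F i x).
Proof.
move=> pF; have -> : (fun x => \sum_(i <- r | P i) F i x) = \sum_(i <- r | P i) F i.
  by apply/funext => x; rewrite fct_sumE.
by elim/big_ind : _ => //; [exact: polyfun_cst|exact: polyfunD].
Qed.

Lemma polyfun_prod (I : Type) (r : seq I) (P : pred I) (F : I -> E -> R) :
  (forall i, P i -> polyfun (F i)) -> polyfun (fun x => \prod_(i <- r | P i) F i x).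
Proof.
move=> pF; elim: r => [|i r IH].
  have -> : (fun x => \prod_(i <- [::] | P i) F i x) = fun=> 1.
    by apply/funext => x; rewrite big_nil.
  exact: polyfun_cst.
have -> : (fun x => \prod_(j <- i :: r | P j) F j x) =
    if P i then F i * (fun x => \prod_(j <- r | P j) F j x)
    else fun x => \prod_(j <- r | P j) F j x.
  by apply/funext => x; rewrite big_cons; case: ifP.
by case: ifP => Pi //; apply: polyfunM => //; exact: pF.
Qed.

Lemma polyfun_exp f k : polyfun f -> polyfun (fun x => f x ^+ k).
Proof.
move=> pf; elim: k => [|k IH]; first exact: polyfun_cst.
have -> : (fun x => f x ^+ k.+1) = f * (fun x => f x ^+ k).
  by apply/funext => x; rewrite exprS.
exact: polyfunM.
Qed.

Lemma polyfun_meval (p : mpoly.mpoly n R) :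
  polyfun (fun x => mpoly.meval (fun i => x ord0 i) p).
Proof.
rewrite (_ : (fun x : E => _) = fun x : E => \sum_(a <- mpoly.msupp p)
    mpoly.mcoeff a p * \prod_i x ord0 i ^+ mpoly.fun_of_multinom a i); last first.
  by apply/funext => x; rewrite mpoly.mevalE.
apply: polyfun_sum => a _; apply: (@polyfunM (fun=> _)); first exact: polyfun_cst.
by apply: polyfun_prod => i _; apply: polyfun_exp; exact: polyfun_coord.
Qed.

Lemma polyfun_measurable f : polyfun f ->
  measurable_fun [set: E] (f : _ -> measurableTypeR R).
Proof.
elim=> {f} [c|i|f g _ mf _ mg|f g _ mf _ mg].
- exact: measurable_cst.
- exact: measurable_rV_coord.
- exact: measurable_funD.
- exact: measurable_funM.
Qed.

End polynomial.

Section polynomial_derive.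
Context {R : realType} {n : nat}.
Local Notation E := 'rV[R]_n.+1.

Lemma polyfun_continuous (f : E -> R) : polyfun f -> continuous f.
Proof.
elim=> {f} [c|i|f g _ mf _ mg|f g _ mf _ mg] x.
- exact: cst_continuous.
- exact: coord_continuous.
- exact: (cvgD (mf x) (mg x)).
- exact: (cvgM (mf x) (mg x)).
Qed.

(** Polynomials are closed under directional derivatives, so that the piecewise
    derivatives of any order are again piecewise polynomial. *)
Lemma polyfun_derive (f : E -> R) (v : E) : polyfun f ->
  exists2 g : E -> R, polyfun g & forall x, is_derive x v f (g x).
Proof.
elim=> {f} [c|i|f g pf [f' pf' df] pg [g' pg' dg]|f g pf [f' pf' df] pg [g' pg' dg]].
- exists (fun=> 0); first exact: polyfun_cst.
  by move=> x; exact: is_derive_cst.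
- exists (fun=> v ord0 i); first exact: polyfun_cst.
  move=> x; have cv : (fun h : R => h^-1 *: ((h *: v + x) ord0 i - x ord0 i))
      @ 0^' --> v ord0 i.
    apply: (@cvg_near_cst _ _ (v ord0 i : R)).
    near=> h; rewrite !mxE addrK scalerA mulVf ?scale1r//.
    by near: h; exact: nbhs_dnbhs_neq.
  apply: DeriveDef; first by apply: cvgP cv.
  exact: cvg_lim cv.
- exists (f' + g'); first exact: polyfunD.
  by move=> x; exact: is_deriveD.
- exists (f * g' + g * f'); first by apply: polyfunD; exact: polyfunM.
  by move=> x; exact: is_deriveM.
Unshelve. all: by end_near. Qed.

(** Directional derivatives at a point depend on the germ of the function there. *)
Lemma partials_local (U : set E) (f g : E -> R) s : open U ->
  (forall x, U x -> f x = g x) -> forall x, U x -> partials s f x = partials s g x.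
Proof.
move=> oU fg; elim: s => //= i s IH x Ux; apply: near_eq_derive.
by apply: filterS IH _; exact: open_nbhs_nbhs.
Qed.

Lemma partials_polyfun (U : set E) (f g : E -> R) s : open U -> polyfun g ->
  (forall x, U x -> f x = g x) ->
  exists2 h, polyfun h & forall x, U x -> partials s f x = h x.
Proof.
move=> oU pg fg; elim: s => [|i s [h ph fh]]; first by exists g.
have [h' ph' dh] := polyfun_derive (delta_mx ord0 i) ph.
exists h' => // x Ux /=; rewrite -(@derive_val _ _ _ _ _ _ _ (dh x)).
by apply: near_eq_derive; apply: filterS fh _; exact: open_nbhs_nbhs.
Qed.

Lemma polyfun_bounded (A : set E) (f : E -> R) : bounded_set A -> polyfun f ->
  exists M : R, forall x, A x -> `|f x| <= M.
Proof.
move=> [B [_ /(_ (B + 1))]]; rewrite ltrDl ltr01 => /(_ isT) AB.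
elim=> {f} [c|i|f g _ [M mf] _ [N mg]|f g _ [M mf] _ [N mg]].
- by exists `|c|.
- exists (B + 1) => x /AB; apply: le_trans.
  exact: ler_coord.
- exists (M + N) => x Ax; rewrite (le_trans (ler_normD _ _))// lerD//; [exact: mf|exact: mg].
- exists (M * N) => x Ax; rewrite normrM ler_pM//; [exact: mf|exact: mg].
Qed.
End polynomial_derive.

(** * Lebesgue measure of open and of bounded sets *)

Section lebesgue_rV_theory.
Context {R : realType}.

(** The sigma-algebra is generated by the coordinates; an open set is measurable as
    a countable union of cubes with rational centres. *)
Lemma open_measurable_rV n (U : set 'rV[R]_n) : open U -> measurable U.
Proof.
move=> oU.
pose box (q : {ffun 'I_n -> rat} * nat) : set 'rV[R]_n :=
  [set x | forall i, `|ratr (q.1 i) - x ord0 i| < q.2.+1%:R^-1].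
pose F q := if `[< box q `<=` U >] then box q else set0.
have -> : U = \bigcup_q F q.
  apply/seteqP; split => [x Ux|x [q _]]; last first.
    by rewrite /F; case: asboolP => // + ?; apply.
  have /nbhs_ballP[e /= e0 xeU] : nbhs x U by exact: open_nbhs_nbhs.
  have [k ke] : exists k : nat, k.+1%:R^-1 < e / 2.
    have e20 : 0 < e / 2 by rewrite divr_gt0.
    have [k _ ke] := near_infty_natSinv_lt (PosNum e20).
    by exists k; exact: (ke k (leqnn k)).
  have qx i : exists q : rat, `|ratr q - x ord0 i| < k.+1%:R^-1.
    have : x ord0 i - k.+1%:R^-1 < x ord0 i + k.+1%:R^-1.
      by rewrite ltrD2l gtrN// invr_gt0.
    by move=> /rat_in_itvoo[q]; rewrite in_itv/= -ltr_distl; exists q.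
  have [q qP] := choice qx.
  exists ([ffun i => q i], k) => //; rewrite /F; case: asboolP => [_ /= i|].
    by rewrite ffunE; exact: qP.
  case=> y /= by_; apply: xeU; split=> // i j; rewrite ord1 /ball /= -[_ - _](subrKA (ratr (q j))).
  rewrite (le_lt_trans (ler_normD _ _))// [ltRHS]splitr ltrD//.
    by rewrite distrC (lt_trans (qP j)).
  by have := by_ j; rewrite ffunE => /lt_trans; apply.
apply: countable_bigcupT_measurable => [|q]; first exact: countableP.
rewrite /F; case: asboolP => // _.
have -> : box q = \bigcap_(i in [set: 'I_n])
    ((fun x : 'rV[R]_n => x ord0 i) @^-1` ball (ratr (q.1 i) : R) q.2.+1%:R^-1).
  by apply/seteqP; split => [x qx i _|x qx i]; [exact: qx|exact: (qx i I)].
apply: fin_bigcap_measurable => // i _.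
rewrite -[X in measurable X]setTI; apply: measurable_rV_coord => //.
by apply: open_measurable; exact: ball_open.
Qed.

Lemma measurable_rV_box n (M : R) :
  measurable [set x : 'rV[R]_n | forall i, `|x ord0 i| <= M].
Proof.
rewrite (_ : mkset _ = \bigcap_(i in [set: 'I_n])
    ((fun x : 'rV[R]_n => x ord0 i) @^-1` `[- M, M]%classic)); last first.
  apply/seteqP; split => [x xM i _ /=|x xM i]; first by rewrite in_itv/= -ler_norml.
  by have := xM i I; rewrite /= in_itv/= -ler_norml.
apply: fin_bigcap_measurable => // i _.
by rewrite -[X in measurable X]setTI; apply: measurable_rV_coord.
Qed.

Lemma cons_rV_head n (p : measurableTypeR R * 'rV[R]_n) (j : 'I_1) :
  cons_rV p ord0 (lshift n j : 'I_n.+1) = p.1.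
Proof. by apply: etrans (row_mxEl _ _ _ _) _; rewrite (ord1 j) mxE. Qed.

Lemma cons_rV_tail n (p : measurableTypeR R * 'rV[R]_n) (j : 'I_n) :
  cons_rV p ord0 (rshift 1 j : 'I_n.+1) = p.2 ord0 j.
Proof. exact: row_mxEr. Qed.

Lemma lebesgue_rV_box n (M : R) :
  (lebesgue_rV n [set x : 'rV[R]_n | (forall i, `|x ord0 i| <= M)%R] < +oo)%E.
Proof.
elim: n => [|n IH] /=; first by rewrite diracE ltry.
rewrite /lebesgue_rV_step /pushforward.
rewrite (_ : _ @^-1` _ = `[- M, M]%classic `*`
    [set x : 'rV[R]_n | (forall i, `|x ord0 i| <= M)%R]); last first.
  apply/seteqP; split => [[a x] /= aM|[a x] /= [aM xM] i].
    split => /= [|i].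
      by have := aM (lshift n (ord0 : 'I_1)); rewrite cons_rV_head in_itv/= -ler_norml.
    by have := aM (rshift 1 i); rewrite cons_rV_tail.
  have [j ->|j ->] := split_ordP (i : 'I_(1 + n)); last by rewrite cons_rV_tail.
  by rewrite cons_rV_head ler_norml; move: aM; rewrite in_itv.
rewrite product_measure1E//.
  apply: lte_mul_pinfty => //.
  rewrite ge0_fin_numE//.
  have := lebesgue_measure_itv `[- M, M]; rewrite /= => ->.
  by case: ifP => _; rewrite ltry.
exact: measurable_rV_box.
Qed.

Lemma lebesgue_rV_bounded n (A : set 'rV[R]_n.+1) : measurable A -> bounded_set A ->
  (lebesgue_rV n.+1 A < +oo)%E.
Proof.
move=> mA [B [_ /(_ (B + 1))]]; rewrite ltrDl ltr01 => /(_ isT) AB.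
apply: le_lt_trans (lebesgue_rV_box n.+1 (B + 1)).
apply: le_measure; rewrite ?inE//; first exact: measurable_rV_box.
move=> x /AB xB i; apply: le_trans xB.
exact: ler_coord.
Qed.
End lebesgue_rV_theory.

(** * Locality of derivatives, norms and traces *)

Section locality.
Context {R : realType} {n : nat}.
Local Notation E := 'rV[R]_n.+1.
Local Notation leb := (lebesgue_rV n.+1).
Implicit Types (T : mesh R n) (K : simplex R n).

Lemma L2norm_ge0 (D : set E) m G : 0 <= L2norm D m G.
Proof. exact: sqrtr_ge0. Qed.

Lemma sqr_L2norm (D : set E) m G :
  L2norm D m G ^+ 2 = \int[leb]_(x in D) \sum_(t : m.-tuple 'I_n.+1) G t x ^+ 2.
Proof.
rewrite sqr_sqrtr//; apply: Rintegral_ge0 => x _.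
by apply: sumr_ge0 => t _; exact: sqr_ge0.
Qed.

Lemma eq_L2norm (D : set E) m G H :
  (forall s x, D x -> G s x ^+ 2 = H s x ^+ 2) -> L2norm D m G = L2norm D m H.
Proof.
move=> GH; congr Num.sqrt; apply: eq_Rintegral => x /set_mem Dx.
by apply: eq_bigr => t _; exact: GH.
Qed.

(** The weak derivative is selected from a set of candidates that is determined by
    integrals of the function, and these ignore null sets. *)
Lemma wderiv_ae (U : set E) s (f g : E -> R) :
  f = g %[ae leb in U] -> wderiv U s f = wderiv U s g.
Proof.
move=> fg; rewrite /wderiv; congr (xget _ _); apply/funext => h.
apply/propext; split=> -[h2 hE]; split=> // phi /hE <-;
  by apply: Rintegral_ae_eq; apply: filterS fg => x /[apply] ->.
Qed.

Lemma Dnc_local T (U : set E) s (v w : E -> R) : open U ->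
  (forall x, U x -> v x = w x) -> forall x, U x -> Dnc T s v x = Dnc T s w x.
Proof.
move=> oU vw x Ux; rewrite /Dnc !patchE; case: ifP => // _.
exact: (partials_local s oU vw).
Qed.

Lemma eq_trace_from K (g h : E -> R) x :
  (forall y, (hull K)° y -> g y = h y) -> trace_from K g x = trace_from K h x.
Proof.
have sub (u v : E -> R) : (forall y, (hull K)° y -> u y = v y) ->
    u @ within (hull K)° (nbhs x) --> v @ within (hull K)° (nbhs x).
  by move=> uv; apply: fmap_within_eq => y /set_mem /uv.
move=> gh; rewrite /trace_from; congr (lim _); apply/seteqP; split; apply: sub => //.
by move=> y /gh.
Qed.

(** The traces on F are taken from the interiors of the elements with side F, so
    the values of the function elsewhere have no influence on its jump. *)
Lemma eq_tangential_jump_norm m T F nu (v w : E -> R) :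
  (forall K, K \in T -> F \in sides K -> forall y, (hull K)° y -> v y = w y) ->
  tangential_jump_norm m T F nu v = tangential_jump_norm m T F nu w.
Proof.
move=> vw; have J s : jump T F nu (Dnc T s v) = jump T F nu (Dnc T s w).
  apply/funext => x; rewrite /jump big_seq_cond [RHS]big_seq_cond.
  apply: eq_bigr => K /andP[KT FK]; congr (_ * _); apply: eq_trace_from.
  by apply: Dnc_local; [exact: open_interior|exact: vw].
pose Psi (J : seq 'I_n.+1 -> E -> R) := Num.sqrt (side_integral F (fun x =>
  \sum_(t : m.-1.-tuple 'I_n.+1) \sum_i
    (J (i :: t) x - (\sum_j J (j :: t) x * nu ord0 j) * nu ord0 i) ^+ 2)).
exact: (congr1 Psi (funext J)).
Qed.

Lemma refines_interior T T' : refines T' T -> mesh_interior T' `<=` mesh_interior T.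
Proof.
move=> ref x [K' /= /ref[K KT sub] xK']; exists K => //.
exact: interiorS xK'.
Qed.

Lemma piecewise_polyB k k' T T' (v w : E -> R) : refines T' T ->
  piecewise_poly k T' v -> piecewise_poly k' T w ->
  {in T', forall K, exists2 p : E -> R, polyfun p &
    forall x, (hull K)° x -> (v - w) x = p x}.
Proof.
move=> ref [_ pv] [_ pw] K' K'T'; have [K KT sub] := ref _ K'T'.
have [p _ vp] := pv _ K'T'; have [q _ wq] := pw _ KT.
exists ((fun x => mpoly.meval (fun i => x ord0 i) p) -
        (fun x => mpoly.meval (fun i => x ord0 i) q)).
  by apply: polyfunB; exact: polyfun_meval.
move=> x xK'; rewrite !fctE vp// wq//; exact: interiorS xK'.
Qed.

Lemma bounded_subset (A B : set E) : A `<=` B -> bounded_set B -> bounded_set A.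
Proof. by move=> AB; apply: sub_boundedr => P BP x /AB /BP. Qed.

(** Real-valued integrals are zero when the extended one is infinite, so this
    subadditivity rests on the finiteness of every summand, which follows from the
    upper bound on g and the boundedness of the elements. *)
Lemma integral_mesh_interior_le (Om : set E) T (g : E -> R) :
  measurable Om -> {in T, forall K, bounded_set (hull K)} ->
  measurable_fun [set: E] (g : _ -> measurableTypeR R) ->
  (forall x, 0 <= g x) -> (exists M, forall x, g x <= M) ->
  (forall x, ~ mesh_interior T x -> g x = 0) ->
  \int[leb]_(x in Om) g x <= \sum_(K <- T) \int[leb]_(x in (hull K)°) g x.
Proof.
move=> mOm bT mg g0 [M gM] gT.
have mI K : measurable (hull K)° by apply: open_measurable_rV; exact: open_interior.
have mgE D : measurable_fun D (EFin \o g).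
  by apply: measurable_funTS; apply/measurable_EFinP.
have mr K : measurable_fun [set: E] ((EFin \o g) \_ (hull K)°).
  by apply/(measurable_restrict (EFin \o g) (mI K) measurableT); exact: mgE.
have fin K : K \in T -> (\int[leb]_(x in (hull K)°) (g x)%:E < +oo)%E.
  move=> KT; have bI : (leb (hull K)° < +oo)%E.
    apply: lebesgue_rV_bounded => //.
    exact: bounded_subset (@interior_subset _ _) (bT _ KT).
  apply: (@le_lt_trans _ _ (\int[leb]_(x in (hull K)°) (cst M%:E) x)%E).
    apply: ge0_le_integral => //.
    - by move=> x _; rewrite lee_fin.
    - by move=> x _; rewrite lee_fin.
  rewrite integral_cst// lte_mul_pinfty//.
  by rewrite lee_fin (le_trans (g0 0)).
have finN K : K \in T -> (\int[leb]_(x in (hull K)°) (g x)%:E \is a fin_num)%E.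
  by move=> KT; rewrite ge0_fin_numE ?fin//; apply: integral_ge0 => x _; rewrite lee_fin.
have -> : \sum_(K <- T) \int[leb]_(x in (hull K)°) g x =
    fine (\sum_(K <- T) \int[leb]_(x in (hull K)°) (g x)%:E)%E.
  by rewrite big_seq sum_fine -?big_seq// => K; exact: finN.
have Sfin : (\sum_(K <- T) \int[leb]_(x in (hull K)°) (g x)%:E)%E \is a fin_num.
  by apply/sum_fin_numP => K KT _; exact: finN.
suff le : (\int[leb]_(x in Om) (g x)%:E <=
    \sum_(K <- T) \int[leb]_(x in (hull K)°) (g x)%:E)%E.
  apply: fine_le => //; rewrite ge0_fin_numE.
    by rewrite (le_lt_trans le)// ltey_eq Sfin.
  by apply: integral_ge0 => x _; rewrite lee_fin.
apply: (@le_trans _ _ (\int[leb]_(x in setT) (g x)%:E)%E).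
  by apply: ge0_subset_integral => // x _; rewrite lee_fin.
apply: (@le_trans _ _ (\int[leb]_x \sum_(K <- T) ((EFin \o g) \_ (hull K)°) x)%E).
  have r0 K x : (0 <= ((EFin \o g) \_ (hull K)°) x)%E.
    by rewrite patchE; case: ifP; rewrite //= lee_fin.
  apply: ge0_le_integral => //.
  - by move=> x _; rewrite lee_fin.
  - by apply: emeasurable_sum => K _; exact: mr.
  move=> x _; have [[K /= KT xK]|/gT ->] := pselect (mesh_interior T x); last first.
    by apply: sume_ge0.
  rewrite (big_rem K)//= patchE mem_set//= leeDl//; exact: sume_ge0.
rewrite ge0_integral_sum//.
- by under eq_bigr do rewrite -integral_mkcond.
- by move=> K x _; rewrite patchE; case: ifP; rewrite //= lee_fin.
Qed.
End locality.

(** * Distance and diameter *)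

Section euclid.
Context {R : realType} {n : nat}.
Local Notation E := 'rV[R]_n.+1.
Implicit Types (x y z : E) (A B : set E).

Lemma dotDr z x y : dot z (x + y) = dot z x + dot z y.
Proof. by rewrite /dot -big_split; apply: eq_bigr => i _; rewrite mxE mulrDr. Qed.

Lemma dotZr z (a : R) x : dot z (a *: x) = a * dot z x.
Proof. by rewrite /dot mulr_sumr; apply: eq_bigr => i _; rewrite mxE mulrCA. Qed.

Lemma dot_sumr z (I : Type) (r : seq I) (P : pred I) (F : I -> E) :
  dot z (\sum_(i <- r | P i) F i) = \sum_(i <- r | P i) dot z (F i).
Proof.
apply: (big_morph (dot z) (dotDr z)).
by rewrite /dot big1// => i _; rewrite mxE mulr0.
Qed.

Lemma enorm0 : enorm (0 : E) = 0.
Proof. by rewrite /enorm /dot big1 ?sqrtr0// => i _; rewrite mxE mulr0. Qed.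

Lemma enorm_ge0 x : 0 <= enorm x. Proof. exact: sqrtr_ge0. Qed.

Lemma enormN x : enorm (- x) = enorm x.
Proof.
by congr Num.sqrt; apply: eq_bigr => i _; rewrite mxE mulrNN.
Qed.

Lemma ler_coord_enorm x i : `|x ord0 i| <= enorm x.
Proof.
rewrite -sqrtr_sqr ler_wsqrtr// /dot (bigD1 i)//= -expr2 lerDl.
by apply: sumr_ge0 => j _; rewrite -expr2 sqr_ge0.
Qed.

Lemma enorm_le x (B : R) : `|x| <= B -> enorm x <= Num.sqrt (\sum_(i < n.+1) B ^+ 2).
Proof.
move=> xB; rewrite ler_wsqrtr//; apply: ler_sum => i _.
by rewrite -expr2 -real_normK ?num_real// lerXn2r ?nnegrE// ?(le_trans (ler_coord x i))//
  (le_trans _ xB).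
Qed.

Lemma sup_ge0 (S : set R) : (forall s, S s -> 0 <= s) -> 0 <= sup S.
Proof.
move=> S0; have [hS|/sup_out ->//] := pselect (has_sup S).
by have [[s Ss] _] := hS; rewrite (le_trans (S0 _ Ss))//; exact: ub_le_sup hS.2 _ Ss.
Qed.

Lemma diam_ge0 A : 0 <= diam A.
Proof. by apply: sup_ge0 => _ [x _ [y _ <-]]; exact: enorm_ge0. Qed.

Lemma diamS A B : bounded_set B -> A `<=` B -> diam A <= diam B.
Proof.
move=> [M [_ /(_ (M + 1))]]; rewrite ltrDl ltr01 => /(_ isT) BM AB.
have [->|/set0P[x Ax]] := eqVneq A set0.
  have e0 : [set enorm (x - y) | x in (set0 : set E) & y in (set0 : set E)] = set0.
    by apply/seteqP; split=> // _ [x []].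
  by rewrite [leLHS]/diam e0 sup0 diam_ge0.
have SB : has_ubound [set enorm (x - y) | x in B & y in B].
  exists (Num.sqrt (\sum_(i < n.+1) (M + 1 + (M + 1)) ^+ 2)) => _ [u Bu [v Bv <-]].
  by apply: enorm_le; rewrite (le_trans (ler_normB _ _))// lerD//; exact: BM.
apply: sup_le => [_ [u Au [v Av <-]]||].
- by apply: le_down; exists u; [exact: AB|exists v => //; exact: AB].
- by exists (enorm (x - x)), x => //; exists x.
- by split=> //; exists (enorm (x - x)), x; [exact: AB|exists x => //; exact: AB].
Qed.

Lemma dist_sym A B : dist A B = dist B A.
Proof.
rewrite /dist; congr inf; apply/seteqP; split=> _ [x Ax [y By <-]];
  by exists y => //; exists x => //; rewrite -enormN opprB.
Qed.

Lemma dist_self A : A !=set0 -> dist A A = 0.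
Proof.
move=> [x Ax]; apply/eqP; rewrite eq_le; apply/andP; split.
  have lb : has_lbound [set enorm (x - y) | x in A & y in A].
    by exists 0 => _ [u _ [v _ <-]]; exact: enorm_ge0.
  apply: (ge_inf lb); exists x => //; exists x => //; by rewrite subrr enorm0.
apply: lb_le_inf; first by exists (enorm (x - x)), x => //; exists x.
by move=> _ [u _ [v _ <-]]; exact: enorm_ge0.
Qed.

(** The set of differences x - y is compact, hence closed; if 0 is not in it, a
    ball around 0 is not met and the distance is at least its radius. *)
Lemma dist_eq0_meet A B : compact A -> compact B -> A !=set0 -> B !=set0 ->
  dist A B = 0 -> (A `&` B) !=set0.
Proof.
move=> cA cB [x0 Ax0] [y0 By0] d0.
pose D : set E := (fun p : E * E => p.1 - p.2) @` (A `*` B).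
have cD : compact D.
  apply: continuous_compact; last exact: compact_setX.
  apply: continuous_subspaceT => p.
  by apply: cvgB; [exact: cvg_fst|exact: cvg_snd].
have clD : closed D by exact: compact_closed (@norm_hausdorff _ _) cD.
have [[[x y] /= [Ax By] xy0]|nD0] := pselect (D 0).
  by exists x; split => //; rewrite (subr0_eq xy0).
have : nbhs (0 : E) (~` D) by apply: open_nbhs_nbhs; split => //; exact: closed_openC.
move=> /nbhs_ballP[e /= e0 eD].
suff : e <= dist A B by rewrite d0 leNgt e0.
apply: lb_le_inf; first by exists (enorm (x0 - y0)), x0 => //; exists y0.
move=> _ [x Ax [y By <-]]; rewrite leNgt; apply/negP => xye.
apply: (eD (x - y)); last by exists (x, y).
split=> // i j; rewrite ord1 /ball /= mxE sub0r normrN.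
exact: le_lt_trans (ler_coord_enorm _ _) xye.
Qed.
End euclid.

(** * Barycentric coordinates *)

Section simplices.
Context {R : realType} {n : nat}.
Local Notation E := 'rV[R]_n.+1.
Implicit Types (K F L : simplex R n) (T : mesh R n).

Lemma hull0 : hull (fset0 : simplex R n) = set0.
Proof.
apply/seteqP; split=> // x [a [_ + _]]; rewrite big_seq_fset0 => /esym/eqP.
by rewrite oner_eq0.
Qed.

Lemma sub_hull F K : {subset F <= K} -> hull F `<=` hull K.
Proof.
move=> FK x [a [a0 a1 ->]]; exists (fun v => if v \in F then a v else 0).
have FKE (V : nmodType) (H : E -> V) :
    \sum_(v <- K) (if v \in F then H v else 0) = \sum_(v <- F) H v.
  rewrite -(@big_fset_incl _ _ _ _ F K)//=.
  - by apply: eq_big_seq => v ->.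
  - exact/fsubsetP.
  - by move=> v _ /negbTE ->.
split.
- by move=> v _; case: ifP => // /a0.
- by rewrite FKE.
- rewrite -(FKE _ (fun v => a v *: v)); apply: eq_bigr => v _.
  by case: ifP => //; rewrite scale0r.
Qed.

Lemma vertex_hull K v : v \in K -> hull K v.
Proof.
move=> vK; exists (fun x => (x == v)%:R); split.
- by move=> x _; rewrite ler0n.
- rewrite (big_fsetD1 v)//= eqxx big1_fset ?addr0// => x.
  by rewrite !inE => /andP[/negbTE->].
- rewrite (big_fsetD1 v)//= eqxx scale1r big1_fset ?addr0// => x.
  by rewrite !inE => /andP[/negbTE->]; rewrite scale0r.
Qed.

Lemma hull_neq0 K : nsimplex K -> hull K !=set0.
Proof.
move=> [cK _]; have [v vK] : exists v, v \in K by apply/fset0Pn; rewrite -cardfs_gt0 cK.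
by exists v; exact: vertex_hull.
Qed.

Lemma barycentric_unique K (a b : E -> R) : affinely_independent K ->
  \sum_(v <- K) a v = \sum_(v <- K) b v ->
  \sum_(v <- K) a v *: v = \sum_(v <- K) b v *: v -> {in K, a =1 b}.
Proof.
move=> aK ab abv v vK; apply/eqP; rewrite -subr_eq0; apply/eqP.
apply: (aK (fun v => a v - b v)) => //.
  by rewrite sumrB ab subrr.
by under eq_bigr do rewrite scalerBl; rewrite sumrB abv subrr.
Qed.

(** The matrix with the rows (1, v), v a vertex, is square, and affine independence
    makes it invertible; the coordinates of p are the entries of (1, p) times its
    inverse, so they are polynomial in p, in particular continuous. *)
Lemma barycentric_coordinates K : nsimplex K ->
  exists c : E -> E -> R, (forall v, polyfun (c v)) /\
    forall p, \sum_(v <- K) c v p = 1 /\ p = \sum_(v <- K) c v p *: v.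
Proof.
move=> [cK aK].
have uK : uniq K by exact: fset_uniq.
have nK (i : 'I_n.+2) : nth 0 K i \in K by apply: mem_nth; rewrite cK.
pose M : 'M[R]_(1 + n.+1) := \matrix_(i < n.+2) row_mx (1%:M : 'M[R]_1) (nth 0 K i).
have MM (a : 'rV[R]_(1 + n.+1)) : a *m M =
    row_mx (\sum_i a ord0 i)%:M (\sum_i a ord0 i *: nth 0 K i).
  rewrite mulmx_sum_row; apply/rowP => j; rewrite summxE.
  have [k ->|k ->] := split_ordP j.
    rewrite row_mxEl (ord1 k) mxE mulr1n; apply: eq_bigr => i _.
    by rewrite 3!mxE row_mxEl mxE mulr1.
  rewrite row_mxEr summxE; apply: eq_bigr => i _.
  by rewrite 3!mxE row_mxEr [RHS]mxE.
have idxK (i : 'I_n.+2) : inord (index (nth 0 K i) K) = i :> 'I_n.+2.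
  by rewrite index_uniq ?cK// inord_val.
have sumK (V : nmodType) (H : 'I_n.+2 -> E -> V) :
    \sum_(v <- K) H (inord (index v K)) v = \sum_i H i (nth 0 K i).
  rewrite (big_nth 0) (_ : size K = n.+2)// big_mkord.
  by apply: eq_bigr => i _; rewrite idxK.
have uM : M \in unitmx.
  rewrite -row_free_unit; apply: inj_row_free => a.
  rewrite MM -row_mx0 => /eq_row_mx[a0 av]; apply/rowP => i.
  have := aK (fun v => a ord0 (inord (index v K))).
  rewrite (sumK _ (fun i _ => a ord0 i)) (sumK _ (fun i v => a ord0 i *: v)).
  have a1 : \sum_i a ord0 i = 0.
    by have /matrixP/(_ ord0 ord0) := a0; rewrite !mxE mulr1n.
  by move=> /(_ a1 av _ (nK i)); rewrite idxK row_mx0 mxE.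
exists (fun v p => (row_mx (1%:M : 'M[R]_1) p *m invmx M) ord0 (inord (index v K))).
split.
  move=> v; rewrite (_ : (fun p : E => _) = fun p : E =>
     \sum_j (row_mx (1%:M : 'M[R]_1) p) ord0 j * invmx M j (inord (index v K))); last first.
    by apply/funext => p; rewrite mxE.
  apply: polyfun_sum => j _; apply: (@polyfunM _ _ _ (fun=> _)); last exact: polyfun_cst.
  have [k ->|k ->] := split_ordP j.
    rewrite (_ : (fun p : E => _) = fun=> (1%:M : 'M[R]_1) ord0 k); first exact: polyfun_cst.
    by apply/funext => p; rewrite row_mxEl.
  rewrite (_ : (fun p : E => _) = fun p => p ord0 k); first exact: polyfun_coord.
  by apply/funext => p; rewrite row_mxEr.
move=> p; set c := row_mx _ p *m _.
rewrite (sumK _ (fun i _ => c ord0 i)) (sumK _ (fun i v => c ord0 i *: v)).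
have := MM c; rewrite mulmxKV// => /eq_row_mx[e1 ep].
split=> //; have /matrixP/(_ ord0 ord0) := e1.
by rewrite !mxE mulr1n.
Qed.
End simplices.

(** * Topology of simplices *)

Section simplex_topology.
Context {R : realType} {n : nat}.
Local Notation E := 'rV[R]_n.+1.
Implicit Types (K F L : simplex R n) (T : mesh R n).

Lemma hull_bounded K : bounded_set (hull K).
Proof.
exists (\sum_(v <- K) `|v|); split; first exact: num_real.
move=> M ltM x [a [a0 a1 ->]]; apply: le_trans (ltW ltM).
rewrite (le_trans (ler_norm_sum _ _ _))// big_seq [leRHS]big_seq.
apply: ler_sum => v vK; rewrite normrZ (ger0_norm (a0 _ vK)).
rewrite ler_piMl// -a1 (big_fsetD1 v)//= lerDl big_seq.
by apply: sumr_ge0 => w; rewrite !inE => /andP[_ /a0].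
Qed.

Lemma polyfun_ge0_closed (f : E -> R) : polyfun f -> closed [set p | 0 <= f p].
Proof.
move=> /polyfun_continuous cf.
rewrite (_ : mkset _ = f @^-1` [set y | 0 <= y]) //.
by apply: closed_comp => [x _|]; [exact: cf|exact: closed_ge].
Qed.

Lemma polyfun_gt0_open (f : E -> R) : polyfun f -> open [set p | 0 < f p].
Proof.
move=> /polyfun_continuous cf.
rewrite (_ : mkset _ = f @^-1` [set y | 0 < y]) //.
by apply: open_comp => [x _|]; [exact: cf|exact: open_gt].
Qed.

(** A simplex is cut out by the closed conditions that the barycentric coordinates
    are nonnegative. *)
Lemma hull_compact K : nsimplex K -> compact (hull K).
Proof.
move=> sK; apply: bounded_closed_compact; first exact: hull_bounded.
have [c [pc cP]] := barycentric_coordinates sK.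
rewrite (_ : hull K = \bigcap_(v in [set` K]) [set p | 0 <= c v p]).
  by apply: closed_bigI => v _; exact: polyfun_ge0_closed.
apply/seteqP; split=> [p [a [a0 a1 ap]] v /= vK|p cp]; have [c1 pE] := cP p.
  rewrite -(@barycentric_unique _ _ K a (c^~ p) sK.2) ?a0//; first by rewrite a1.
  by rewrite -ap.
by exists (c^~ p); split => // v vK; exact: cp.
Qed.

(** The barycentre is an interior point, because all its barycentric coordinates are
    positive. *)
Lemma interior_hull_neq0 K : nsimplex K -> (hull K)° !=set0.
Proof.
move=> sK; have [c [pc cP]] := barycentric_coordinates sK.
pose N : R := #|` K|%:R; have N0 : 0 < N by rewrite ltr0n sK.1.
have sN (a : R) : \sum_(v <- K) a = N * a.
  by rewrite big_const_seq count_predT iter_addr addr0 mulr_natl.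
pose b : E := \sum_(v <- K) N^-1 *: v.
have cb : {in K, c^~ b =1 fun=> N^-1}.
  have [c1 bE] := cP b; apply: barycentric_unique sK.2 _ _; last by rewrite -bE.
  by rewrite c1 sN mulfV ?gt_eqF.
exists b; apply: (@filterS _ (nbhs b) _ (\bigcap_(v in [set` K]) [set p | 0 < c v p])).
  move=> p Up; have [c1 pE] := cP p; exists (c^~ p); split => // v vK.
  by apply: ltW; exact: Up.
apply: filter_bigI => v vK; apply: open_nbhs_nbhs; split.
  exact: polyfun_gt0_open.
by rewrite /= cb// invr_gt0.
Qed.

(** Elements at distance zero intersect by compactness, and the intersection is the
    hull of the common vertices. *)
Lemma meet_shared_vertex T K L Om : triangulation Om T -> K \in T -> L \in T ->
  dist (hull K) (hull L) = 0 -> exists2 z, z \in K & z \in L.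
Proof.
move=> [sT _ mT] KT LT d0; have [sK sL] := (sT _ KT, sT _ LT).
have [x] := dist_eq0_meet (hull_compact sK) (hull_compact sL)
  (hull_neq0 sK) (hull_neq0 sL) d0.
rewrite mT//; have [->|[z]] := fset_0Vmem (K `&` L)%fset.
  by rewrite hull0.
by rewrite inE => /andP[zK zL] _; exists z.
Qed.

End simplex_topology.

(** * Simplices with a common side *)

Section opposite.
Context {R : realType} {n : nat}.
Local Notation E := 'rV[R]_n.+1.
Implicit Types (K F L : simplex R n) (T : mesh R n) (nu : E).

Lemma sidesP K F : reflect (exists2 v, v \in K & F = (K `\ v)%fset) (F \in sides K).
Proof. exact: imfsetP. Qed.

(** dot nu (p - x0) is the signed height of p over the hyperplane of the side
    opposite to v; it is affine and vanishes at all vertices but v. *)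
Lemma height_barycentric K v x0 nu (a : E -> R) : v \in K ->
  unit_normal (K `\ v)%fset nu -> x0 \in (K `\ v)%fset -> \sum_(x <- K) a x = 1 ->
  dot nu (\sum_(x <- K) a x *: x - x0) = a v * dot nu (v - x0).
Proof.
move=> vK [_ nuP] x0F a1.
have -> : \sum_(x <- K) a x *: x - x0 = \sum_(x <- K) a x *: (x - x0).
  by under [RHS]eq_bigr do rewrite scalerBr; rewrite sumrB -scaler_suml a1 scale1r.
rewrite dot_sumr (big_fsetD1 v)//= dotZr big_seq big1 ?addr0// => x xF.
by rewrite dotZr nuP// mulr0.
Qed.

(** Otherwise the height would vanish at every point, but it is 1 at x0 + nu. *)
Lemma apex_height_neq0 K v x0 nu : nsimplex K -> v \in K ->
  unit_normal (K `\ v)%fset nu -> x0 \in (K `\ v)%fset -> dot nu (v - x0) != 0.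
Proof.
move=> sK vK nuP x0F; have [c [_ cP]] := barycentric_coordinates sK.
have [c1 pE] := cP (nu + x0).
have := height_barycentric vK nuP x0F c1; rewrite -pE addrK => dE.
have : dot nu nu = 1.
  have := nuP.1; rewrite /enorm => /(congr1 (fun r => r ^+ 2)); rewrite expr1n sqr_sqrtr//.
  by apply: sumr_ge0 => i _; rewrite -expr2 sqr_ge0.
rewrite dE => h1; apply/eqP => h0; move: h1; rewrite h0 mulr0 => /eqP.
by rewrite eq_sym oner_eq0.
Qed.

(** If both apices were on the same side, the coordinate of v2 with respect to v1
    would be positive.  Then the points close to the barycentre of F on the segment
    to v2 have nonnegative coordinates in both simplices, so they belong to the
    intersection, which is F; but their coordinate at v2 is positive. *)
Lemma opposite_sides K1 K2 v1 v2 x0 nu F : nsimplex K1 -> nsimplex K2 ->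
  hull K1 `&` hull K2 = hull (K1 `&` K2)%fset -> K1 != K2 ->
  v1 \in K1 -> v2 \in K2 -> F = (K1 `\ v1)%fset -> F = (K2 `\ v2)%fset ->
  unit_normal F nu -> x0 \in F ->
  dot nu (v1 - x0) * dot nu (v2 - x0) < 0.
Proof.
move=> s1 s2 meet K12 v1K v2K FE1 FE2 nuP x0F.
have v1F : v1 \notin F by rewrite FE1 !inE eqxx.
have v2F : v2 \notin F by rewrite FE2 !inE eqxx.
have KE1 : K1 = (v1 |` F)%fset by rewrite FE1 fsetD1K.
have KE2 : K2 = (v2 |` F)%fset by rewrite FE2 fsetD1K.
have v12 : v1 != v2 by apply: contraNneq K12 => v12; rewrite KE1 KE2 v12.
have IF : (K1 `&` K2)%fset = F.
  apply/fsetP => x; rewrite KE1 KE2 !inE; case: (eqVneq x v1) => [->|_] /=.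
    by rewrite (negbTE v12) (negbTE v1F).
  by case: (x \in F); rewrite ?orbT ?andbF.
have h1 : dot nu (v1 - x0) != 0 by apply: (@apex_height_neq0 K1); rewrite -?FE1.
have h2 : dot nu (v2 - x0) != 0 by apply: (@apex_height_neq0 K2); rewrite -?FE2.
rewrite lt_neqAle mulf_neq0//= leNgt; apply/negP => h12.
have [c [_ /(_ v2)[c1 v2E]]] := barycentric_coordinates s1.
have hc : dot nu (v2 - x0) = c v1 v2 * dot nu (v1 - x0).
  by rewrite {1}v2E; apply: height_barycentric; rewrite -?FE1.
have c0 : 0 < c v1 v2.
  move: h12; rewrite hc mulrCA -expr2 pmulr_lgt0//.
  by rewrite exprn_even_gt0.
pose N : R := #|` F|%:R.
have N0 : 0 < N by rewrite ltr0n cardfs_gt0; apply/fset0Pn; exists x0.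
pose S := \sum_(x <- F) `|c x v2|.
have S0 : 0 <= S by apply: sumr_ge0.
(* The value of t solves t * S = (1 - t) / N: the mass (1 - t) / N at each vertex
   of F then outweighs the negative coordinates of t *: v2. *)
pose t := (1 + N * S)^-1.
have D0 : 0 < 1 + N * S by rewrite ltr_wpDr// mulr_ge0// ltW.
have t0 : 0 < t by rewrite invr_gt0.
have t1 : t <= 1 by rewrite invf_le1// lerDl mulr_ge0// ltW.
have tS : t * S <= (1 - t) / N.
  have tD : t * (1 + N * S) = 1 by rewrite mulVf ?gt_eqF.
  rewrite ler_pdivlMr//; have -> : t * S * N = t * (1 + N * S) - t by ring.
  by rewrite tD.
have sN (a : R) : \sum_(v <- F) a = N * a.
  by rewrite big_const_seq count_predT iter_addr addr0 mulr_natl.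
(* p lies on the segment from the barycentre of F to v2. *)
pose p := \sum_(x <- F) ((1 - t) / N) *: x + t *: v2.
have off (V : nmodType) v (G : E -> V -> V) (A : V) (B : E -> V) : v \notin F ->
    \sum_(x <- F) G x (if x == v then A else B x) = \sum_(x <- F) G x (B x).
  by move=> vF; apply: eq_big_seq => x xF; case: eqP => // xv; rewrite -xv xF in vF.
have p2 (a := fun x => if x == v2 then t else (1 - t) / N) :
    \sum_(x <- K2) a x = 1 /\ p = \sum_(x <- K2) a x *: x.
  rewrite KE2 !big_fsetU1//= /a eqxx; split.
    rewrite (off _ _ (fun=> id))// sN mulrCA mulfV ?gt_eqF//; ring.
  rewrite addrC; congr (_ + _); apply: eq_big_seq => x xF.
  by case: eqP => // xv; rewrite -xv xF in v2F.
have p1 : hull K1 p.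
  exists (fun x => t * c x v2 + (if x == v1 then 0 else (1 - t) / N)); split.
  - move=> x; rewrite KE1 !inE; case: (eqVneq x v1) => [->|_] /= xF.
      by rewrite addr0 mulr_ge0// ltW.
    rewrite -lerBlDl sub0r; apply: le_trans tS; rewrite -mulrN ler_pM2l//.
    apply: (@le_trans _ _ `|c x v2|); first by rewrite -normrN ler_norm.
    by rewrite /S (big_fsetD1 x)//= lerDl sumr_ge0.
  - rewrite big_split/= -mulr_sumr c1 KE1 big_fsetU1//= eqxx add0r.
    rewrite (off _ _ (fun=> id))// sN mulrCA mulfV ?gt_eqF//; ring.
  - under eq_bigr do rewrite scalerDl -scalerA.
    rewrite big_split/= -scaler_sumr -v2E KE1 big_fsetU1//= eqxx scale0r add0r addrC.
    congr (_ + _); apply: eq_big_seq => x xF.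
    by case: eqP => // xv; rewrite -xv xF in v1F.
have : hull F p.
  rewrite -IF -meet; split => //.
  exists (fun x => if x == v2 then t else (1 - t) / N); split; rewrite ?p2.1 ?p2.2//.
  by move=> x _; case: ifP => _; [exact: ltW|rewrite divr_ge0 ?subr_ge0// ltW].
move=> [d [_ d1 pd]].
have dF : \sum_(x <- K2) (if x == v2 then 0 else d x) = 1 /\
    \sum_(x <- K2) (if x == v2 then 0 else d x) *: x = p.
  rewrite KE2 !big_fsetU1//= eqxx scale0r !add0r pd -d1 (off _ _ (fun=> id))//.
  split=> //; apply: eq_big_seq => x xF.
  by case: eqP => // xv; rewrite -xv xF in v2F.
have := barycentric_unique s2.2 (etrans p2.1 (esym dF.1))
  (etrans (esym p2.2) (esym dF.2)) v2K.
by rewrite /= eqxx => t00; rewrite t00 ltxx in t0.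
Qed.
End opposite.

(** * Sides and elements of a patch *)

(** Of three elements with a common side, two lie on the same side of it. *)
Lemma mulr_same_side_ge0 (R : realDomainType) (a b c : R) :
  a * c < 0 -> b * c < 0 -> 0 <= a * b.
Proof. by case: (ltrgt0P c) => *; nra. Qed.

Section mesh.
Context {R : realType} {n : nat}.
Local Notation E := 'rV[R]_n.+1.
Implicit Types (K F L : simplex R n) (T : mesh R n) (nu : E) (Om : set E).

(** The height of an interior point is that of the apex times a nonnegative
    coordinate, and points_out makes it negative. *)
Lemma points_out_height K F v x0 nu : nsimplex K -> v \in K -> F = (K `\ v)%fset ->
  unit_normal F nu -> x0 \in F -> points_out K F nu -> dot nu (v - x0) < 0.
Proof.
move=> sK vK FE nuP x0F out; have [y yI] := interior_hull_neq0 sK.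
have x0h := vertex_hull x0F.
have := out _ _ x0h yI; have [a [a0 a1 ->]] := interior_subset yI.
rewrite (@height_barycentric _ _ _ v)// -?FE//; apply: contraTT.
by rewrite -!leNgt => h0; rewrite mulr_ge0// a0.
Qed.

(** On a boundary side the normal points out of every element with that side, so
    there is just one such element.  On an interior side the two elements in the
    patch lie on opposite sides, which leaves no room for a third one. *)
Lemma patch_side_elements Om T K F (nu : simplex R n -> E) K' :
  triangulation Om T ->
  (forall L, L \in T -> F \in sides L ->
    unit_normal F (nu F) /\ (hull F `<=` bdry Om -> points_out L F (nu F))) ->
  F \in patch_sides Om T K -> K' \in T -> F \in sides K' -> K' \in patch_of T K.
Proof.
move=> [sT _ mT] nuF FP K'T FK'.
have [/bigfcupP[L0 /andP[L0P _] FL0] side] : F \in (\bigcup_(L <- patch_of T K) sides L)%fset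
    /\ is_patch_side Om T K F.
  by move: FP; rewrite 2!inE => /andP[? /asboolP].
have PT L : L \in patch_of T K -> L \in T by rewrite !inE => /andP[].
have [v' v'K' FE'] := sidesP _ _ FK'.
have [nuP out'] := nuF _ K'T FK'.
have [x0 x0F] : exists x0, x0 \in F.
  apply/fset0Pn; rewrite -cardfs_gt0 FE'; have := (sT _ K'T).1.
  by rewrite (cardfsD1 v') v'K' add1n => -[->].
have opp L v : L \in T -> L != K' -> v \in L -> F = (L `\ v)%fset ->
    dot (nu F) (v - x0) * dot (nu F) (v' - x0) < 0.
  move=> LT LK vL FE; apply: (@opposite_sides _ _ L K' _ _ _ _ F) => //.
  - exact: sT. - exact: sT. - exact: mT.
case: side => [bF|[K1 [K2 [K1P K2P K12 FK1 FK2]]]].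
  have [<-//|LK] := eqVneq L0 K'.
  have LT := PT _ L0P.
  have [v vL FE] := sidesP _ _ FL0.
  have := opp _ _ LT LK vL FE; rewrite ltNge; apply: contraNT => _.
  apply: mulr_le0; apply: ltW.
    exact: (points_out_height (sT _ LT) vL FE nuP x0F ((nuF _ LT FL0).2 bF)).
  exact: (points_out_height (sT _ K'T) v'K' FE' nuP x0F (out' bF)).
have [<-//|K1K'] := eqVneq K1 K'; have [<-//|K2K'] := eqVneq K2 K'.
have [v1 v1K FE1] := sidesP _ _ FK1; have [v2 v2K FE2] := sidesP _ _ FK2.
have o1 := opp _ _ (PT _ K1P) K1K' v1K FE1.
have o2 := opp _ _ (PT _ K2P) K2K' v2K FE2.
have := opposite_sides (sT _ (PT _ K1P)) (sT _ (PT _ K2P))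
  (mT _ _ (PT _ K1P) (PT _ K2P)) K12 v1K v2K FE1 FE2 nuP x0F.
by rewrite ltNge (mulr_same_side_ge0 o1 o2).
Qed.

Lemma mem_patch_of T K : K \in T -> nsimplex K -> K \in patch_of T K.
Proof.
by move=> KT sK; rewrite !inE KT/= dist_self//; exact: hull_neq0.
Qed.

Lemma interior_patch_domain T K L : L \in patch_of T K ->
  (hull L)° `<=` patch_domain T K.
Proof. by move=> LP; apply: interiorS => x xL; exists L. Qed.

Lemma mu_loc_patch Om T K m (nu : simplex R n -> E) (u : E -> R) :
  triangulation Om T ->
  (forall L F, L \in T -> F \in sides L ->
    unit_normal F (nu F) /\ (hull F `<=` bdry Om -> points_out L F (nu F))) ->
  mu_loc Om nu m T K (u \_ (patch_domain T K)) = mu_loc Om nu m T K u.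
Proof.
move=> tri nuT; have jE F : F \in patch_sides Om T K ->
    tangential_jump_norm m T F (nu F) (u \_ (patch_domain T K)) =
    tangential_jump_norm m T F (nu F) u.
  move=> FP; apply: eq_tangential_jump_norm => L LT FL y yL.
  rewrite patchE mem_set//; apply: (interior_patch_domain _ yL).
  by apply: patch_side_elements tri _ FP LT FL => L' L'T FL'; exact: nuT.
rewrite /mu_loc; apply: (congr1 Num.sqrt); apply: eq_big_seq => F FP.
by rewrite (jE F FP).
Qed.

(** A supremum is an upper bound only if the patch sizes are bounded:
    every element of the patch of K contains a vertex of K, and there are n.+2 of
    these, each in at most as many elements as the reference patches contain. *)
Lemma card_patch_le_max (TT : set (mesh R n)) Om T K :
  (forall T, TT T -> triangulation Om T) -> finitely_many_patches TT ->
  TT T -> K \in T -> (#|` patch_of T K|)%:R <= max_patch_card TT :> R.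
Proof.
move=> tri [J [C [_ CP]]] TT_T KT; apply: ub_le_sup; last by exists T, K.
pose B := (\sum_(j < J) #|` C j|)%N.
exists (n.+2 * B)%:R => _ [T' [K' [TT' K'T' ->]]]; rewrite ler_nat.
have sK' : nsimplex K' by have [sT _ _] := tri _ TT'; exact: sT.
have vB z : z \in K' -> (#|` vertex_patch T' z| <= B)%N.
  move=> zK'; have [h [j [_ ->]]] := CP _ z TT' (ex_intro2 _ _ K' K'T' zK').
  apply: leq_trans (leq_imfset_card _ _ _) _.
  by rewrite /B (bigD1 j)//= leq_addr.
apply: (@leq_trans (size (flatten [seq (vertex_patch T' z : seq _) | z <- K']))).
  apply: uniq_leq_size; first exact: fset_uniq.
  move=> L; rewrite !inE => /andP[LT /eqP d0].
  have [z zK zL] := meet_shared_vertex (tri _ TT') K'T' LT d0.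
  apply/flatten_mapP; exists z => //; by rewrite !inE LT.
rewrite size_flatten /shape -map_comp sumnE big_map -sK'.1.
rewrite -sum1_size big_distrl/= big_seq [leqRHS]big_seq.
by apply: leq_sum => z zK; rewrite mul1n; exact: vB.
Qed.

End mesh.

(** * Counting over patches *)

Section sums.
Context {R : numDomainType}.

Lemma ler_sum_fsub (I : choiceType) (A B : {fset I}) (a : I -> R) :
  (forall i, 0 <= a i) -> {subset A <= B} -> \sum_(i <- A) a i <= \sum_(i <- B) a i.
Proof.
move=> a0 AB; rewrite [leRHS](big_fsetID _ (mem A))/=.
rewrite (_ : [fset x in B | x \in A]%fset = A); last first.
  by apply/fsetP => x; rewrite !inE andb_idl// => /AB.
by rewrite lerDl sumr_ge0.
Qed.

Lemma ler_sum_cover (I J : choiceType) (X : {fset I}) (Y : {fset J})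
    (S : J -> {fset I}) (a : I -> R) :
  (forall i, 0 <= a i) -> {in X, forall i, exists2 j, j \in Y & i \in S j} ->
  \sum_(i <- X) a i <= \sum_(j <- Y) \sum_(i <- S j) a i.
Proof.
move=> a0 XY.
apply: (@le_trans _ _ (\sum_(i <- X) \sum_(j <- Y | i \in S j) a i)).
  rewrite big_seq [leRHS]big_seq; apply: ler_sum => i /XY[j jY ij].
  rewrite big_mkcond (big_fsetD1 j)//= ij lerDl.
  by apply: sumr_ge0 => k _; case: ifP.
rewrite (exchange_big_dep xpredT)//=; apply: ler_sum => j _.
rewrite big_fset_condE; apply: ler_sum_fsub => // i.
by rewrite !inE => /andP[].
Qed.

End sums.

Section counting.
Context {R : realType} {n : nat}.
Implicit Types (K L : simplex R n) (T : mesh R n).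

Lemma sum_patch_of T K (B : simplex R n -> R) :
  \sum_(L <- patch_of T K) B L =
  \sum_(L <- T | dist (hull K) (hull L) == 0) B L.
Proof. by rewrite [RHS]big_fset_condE. Qed.

(** Exchange the sums: L is counted for the refined elements K at distance zero from
    it, which are elements of the patch of L.  If there is any, L is in the refined
    neighbourhood. *)
Lemma sum_patches_le T T' (M : R) (B : simplex R n -> R) :
  (forall L, 0 <= B L) -> {in T, forall K, (#|` patch_of T K|)%:R <= M} ->
  \sum_(K <- T | K \notin T') \sum_(L <- patch_of T K) B L <=
    M * \sum_(L <- refined_nbhd T T') B L.
Proof.
move=> B0 TM; have -> : refined_nbhd T T' =
    [fset L in T | L \in refined_nbhd T T']%fset.
  by apply/fsetP => L; rewrite !inE andbA andbb.
rewrite -big_fset_condE mulr_sumr [leRHS]big_mkcond.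
under [leLHS]eq_bigr do rewrite sum_patch_of.
rewrite (exchange_big_dep xpredT)//= big_seq [leRHS]big_seq.
apply: ler_sum => L LT; case: ifPn => [_|LR].
  apply: (@le_trans _ _ (\sum_(K <- patch_of T L) B L)).
    rewrite sum_patch_of big_mkcond [leRHS]big_mkcond/=; apply: ler_sum => K _.
    rewrite dist_sym; case: (dist _ _ == 0); rewrite ?andbF//.
    by rewrite andbT; case: ifP.
  rewrite big_const_seq count_predT iter_addr addr0 -mulr_natl.
  by rewrite ler_wpM2r// TM.
rewrite big_seq_cond big_pred0// => K; apply: contraNF LR => /and3P[KT KT' d0].
rewrite !inE LT/=; apply/asboolP; exists K; first by rewrite inE KT' KT.
by rewrite dist_sym; exact/eqP.
Qed.

Lemma sum_patch_sides_le Om T K (a : simplex R n -> R) :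
  (forall F, 0 <= a F) ->
  \sum_(F <- patch_sides Om T K) a F <= \sum_(L <- patch_of T K) \sum_(F <- sides L) a F.
Proof.
move=> a0; apply: ler_sum_cover => // F; rewrite 2!inE => /andP[+ _].
by move=> /bigfcupP[L /andP[LP _] FL]; exists L.
Qed.

Lemma diam_side K F : F \in sides K -> diam (hull F) <= diam (hull K).
Proof.
move=> /sidesP[v vK ->]; apply: diamS; first exact: hull_bounded.
by apply: sub_hull => x; rewrite !inE => /andP[].
Qed.

End counting.

(** * Refinements and piecewise polynomials *)

Section refinement.
Context {R : realType} {n : nat} (Om : set 'rV[R]_n.+1).
Context (adm : mesh R n -> mesh R n -> Prop) (T0 : mesh R n).
Hypothesis T0_tri : triangulation Om T0.
Hypothesis adm_ref : forall T T', refinements adm T0 T -> adm T T' ->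
  triangulation Om T' /\ refines T' T.

Lemma refinements_trans T T' : refinements adm T0 T -> refinements adm T T' ->
  refinements adm T0 T'.
Proof. exact: rt_trans. Qed.

Lemma refinements_refines T T' : refinements adm T0 T -> refinements adm T T' ->
  refines T' T.
Proof.
move=> T0T TT'; elim: TT' T0T => {T T'} [T T' a T0T|T _|T T1 T2 T_1 IH1 T_2 IH2 T0T].
- by have [] := adm_ref T0T a.
- by move=> K KT; exists K.
- move=> K KT2; have [K1 K1T1 sub1] := IH2 (refinements_trans T0T T_1) K KT2.
  have [K0 K0T sub0] := IH1 T0T K1 K1T1.
  by exists K0 => //; exact: subset_trans sub0.
Qed.

Lemma refinements_triangulation T : refinements adm T0 T -> triangulation Om T.
Proof.
move=> T0T; case: (clos_rt_rtn1 _ _ _ _ T0T) => // T1 T2 a rT1.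
have T01 : refinements adm T0 T1 by exact: clos_rtn1_rt rT1.
by have [] := adm_ref T01 a.
Qed.
End refinement.

Section piecewise.
Context {R : realType} {n : nat}.
Local Notation E := 'rV[R]_n.+1.
Implicit Types (K : simplex R n) (T : mesh R n).

Lemma partials_eq0 (U : set E) (f : E -> R) s : open U ->
  (forall x, U x -> f x = 0) -> forall x, U x -> partials s f x = 0.
Proof.
move=> oU f0 x Ux; rewrite (@partials_local _ _ U f (cst 0) s oU f0 x Ux).
suff -> : partials s (cst 0 : E -> R) = cst 0 by [].
elim: s => //= i s ->; apply/funext => y; exact: derive_cst.
Qed.

(** Measurability and boundedness are established for the restriction to the union
    of the interiors of a list of elements, by induction on the list. *)
Lemma Dnc_measurable_bounded T (e : E -> R) s :
  {in T, forall K, exists2 p : E -> R, polyfun p & forall x, (hull K)° x -> e x = p x} ->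
  measurable_fun [set: E] (Dnc T s e : _ -> measurableTypeR R) /\
  exists M, forall x, `|Dnc T s e x| <= M.
Proof.
move=> eT.
have mI K : measurable (hull K)° by apply: open_measurable_rV; exact: open_interior.
have dT K : K \in T -> exists2 h : E -> R, polyfun h &
    forall x, (hull K)° x -> partials s e x = h x.
  by move=> /eT[p pp ep]; apply: partials_polyfun pp ep; exact: open_interior.
have /= : {subset (T : seq _) <= T} by [].
rewrite /Dnc /mesh_interior bigcup_fset.
elim: (T : seq _) => [|K r IH] sub.
  rewrite big_nil (_ : patch _ _ _ = cst 0); last by apply/funext => x; rewrite patchE in_set0.
  by split; [exact: measurable_cst|exists 0 => x; rewrite normr0].
have [mr [M hM]] := IH (fun L Lr => sub _ (mem_behead (s := K :: r) Lr)).
have [h ph eh] := dT K (sub _ (mem_head _ _)).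
have mU : measurable (\big[setU/set0]_(L <- r) (hull L)°).
  by apply: bigsetU_measurable => L _; exact: mI.
have mKU := measurableU _ _ (mI K) mU.
pose g : E -> measurableTypeR R := partials s e.
rewrite big_cons; split.
  apply/(measurable_restrict g mKU measurableT); rewrite setTI.
  apply/(measurable_funU g (mI K) mU); split.
    apply: eq_measurable_fun (measurable_funTS (polyfun_measurable ph)).
    by move=> x /set_mem /eh.
  by move/(measurable_restrict g mU measurableT) : mr; rewrite setTI.
have [N hN] := polyfun_bounded (hull_bounded K) ph.
exists (`|M| + `|N|) => x; rewrite patchE in_setU; have := hM x; rewrite patchE.
have [xK _|xK] := pselect ((hull K)° x).
  rewrite mem_set//= eh// (le_trans (hN _ (interior_subset xK)))//.
  by rewrite (le_trans (ler_norm _))// lerDr.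
rewrite (memNset xK)/= => /le_trans; apply.
by rewrite (le_trans (ler_norm _))// lerDl.
Qed.
End piecewise.

(** * The discrete distance bound *)

Theorem theorem3p3 (R : realType) (n m k : nat) (Om : set 'rV[R]_n.+1)
  (T0 : mesh R n) (adm : mesh R n -> mesh R n -> Prop) (TT : set (mesh R n))
  (nu : simplex R n -> 'rV[R]_n.+1)
  (m_ge1 : (1 <= m)%N)
  (dom_Om : polyhedral_lipschitz_domain Om)
  (T0_tri : triangulation Om T0)
  (TT_def : TT = refinements adm T0)
  (adm_ref : forall T T', TT T -> adm T T' -> triangulation Om T' /\ refines T' T)
  (A2 : finitely_many_patches TT)
  (nu_side : side_orientation Om TT nu)
  (V VC : mesh R n -> set ('rV[R]_n.+1 -> R))
  (J2 : mesh R n -> ('rV[R]_n.+1 -> R) -> ('rV[R]_n.+1 -> R))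
  (J2loc : mesh R n -> simplex R n -> ('rV[R]_n.+1 -> R) -> ('rV[R]_n.+1 -> R))
  (V_poly : forall T, TT T -> V T `<=` piecewise_poly k T)
  (V_sub : forall T, TT T -> linear_subspace (V T))
  (VC_H0 : forall T, TT T -> VC T `<=` H0 m Om)
  (VC_sub : forall T, TT T -> linear_subspace (VC T))
  (VC_fin : forall T, TT T -> fin_dim Om (VC T))
  (J2_lin : forall T, TT T -> linear_operator Om Om (V T) (VC T) (J2 T))
  (J2loc_lin : forall T K, TT T -> K \in T ->
     linear_operator (patch_domain T K) (hull K)°
       (restriction (patch_domain T K) (V T)) (L2fun (hull K)°) (J2loc T K))
  (J2_local : forall T K v, TT T -> K \in T -> V T v ->
     J2 T v = J2loc T K (v \_ (patch_domain T K))
       %[ae lebesgue_rV n.+1 in (hull K)°])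
  (C6 : forall T K w, TT T -> K \in T ->
     restriction (patch_domain T K) (V T `&` H0 m Om) w ->
     w = J2loc T K w %[ae lebesgue_rV n.+1 in (hull K)°])
  (C7 : forall T K w, TT T -> K \in T ->
     restriction (patch_domain T K) (V T) w -> mu_loc Om nu m T K w = 0 ->
     restriction (patch_domain T K) (V T `&` H0 m Om) w)
  (CT : R)
  (CT_bound : forall T K w, TT T -> K \in T ->
     restriction (patch_domain T K) (V T) w ->
     rho_loc m (J2loc T K) T K w <= CT * mu_loc Om nu m T K w)
  (T That : mesh R n)
  (TT_T : TT T)
  (T_That : refinements adm T That)
  (a_h_scalar :
     scalar_product Om (sum_space (V T) (V That)) (a_h Om m That))
  (f u : 'rV[R]_n.+1 -> R)
  (f_L2 : L2fun Om f)
  (u_V : V T u)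
  (u_sol : forall v, V T v ->
     a_h Om m T u v = \int[lebesgue_rV n.+1]_(x in Om) (f x * v x))
  (Ih Ihat : ('rV[R]_n.+1 -> R) -> ('rV[R]_n.+1 -> R))
  (Ih_lin : linear_operator Om Om (sum_space (H0 m Om) (V That)) (V T) Ih)
  (Ihat_lin : linear_operator Om Om (H0 m Om) (V That) Ihat)
  (uhat : 'rV[R]_n.+1 -> R)
  (uhat_def : uhat = Ihat (J2 T u))
  (C3 : forall K vhat, K \in (T `&` That)%fset -> V That vhat ->
     forall x, (hull K)° x -> (vhat - Ih vhat) x = 0)
  (C4 : Ih uhat = u)
  (L5 : R)
  (C5 : forall K v w, K \in T -> H0 m Om v -> V T w ->
     L2norm (hull K)° m (fun s => Dnc That s (Ihat v - w))
       <= L5 * Hm_error m T K v w) :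
  norm_h Om m That (uhat - u) ^+ 2 <=
    (L5 * CT * Num.sqrt (max_patch_card TT)) ^+ 2 *
    \sum_(K <- refined_nbhd T That)
      diam (hull K) *
      \sum_(F <- sides K) tangential_jump_norm m T F (nu F) u ^+ 2.
Proof.
have TT_rf T' : TT T' -> refinements adm T0 T' by rewrite TT_def.
have adm_ref0 T1 T2 : refinements adm T0 T1 -> adm T1 T2 ->
    triangulation Om T2 /\ refines T2 T1.
  by move=> T01; apply: adm_ref; rewrite TT_def.
have TT_That : TT That by rewrite TT_def; exact: refinements_trans (TT_rf _ TT_T) T_That.
have tri T' : TT T' -> triangulation Om T'.
  by move=> /TT_rf; exact: refinements_triangulation.
have ref : refines That T by exact: refinements_refines adm_ref0 _ _ (TT_rf _ TT_T) T_That.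
have J2u : H0 m Om (J2 T u) by have [+ _ _] := J2_lin _ TT_T; move=> /(_ u u_V); exact: (VC_H0 _ TT_T).
have uhatV : V That uhat by rewrite uhat_def; case: Ihat_lin => + _ _; apply.
have e_poly := piecewise_polyB ref (V_poly _ TT_That _ uhatV) (V_poly _ TT_T _ u_V).
have nuT L F : L \in T -> F \in sides L ->
    unit_normal F (nu F) /\ (hull F `<=` bdry Om -> points_out L F (nu F)).
  by move=> LT FL; exact: nu_side _ _ _ TT_T LT FL.
have [sT _ _] := tri _ TT_T.
pose a F := diam (hull F) * tangential_jump_norm m T F (nu F) u ^+ 2.
have a_ge0 F : 0 <= a F by rewrite mulr_ge0 ?diam_ge0 ?sqr_ge0.
pose G s := Dnc That s (uhat - u).
(* On an element kept by the refinement, e = uhat - Ih uhat vanishes. *)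
have kept K : K \in T -> K \in That -> L2norm (hull K)° m G ^+ 2 = 0.
  move=> KT KThat; rewrite sqr_L2norm /Rintegral integral0_eq// => x xK.
  rewrite big1// => t _; rewrite /G /Dnc patchE; case: ifP => _; last by rewrite expr0n.
  rewrite (@partials_eq0 _ _ (hull K)°) ?expr0n//; first exact: open_interior.
  have := C3 K uhat; rewrite C4; apply=> //.
  by rewrite inE KT.
(* By locality, the right-hand side of (C5) for J2 u is rho_loc at the restriction
   w of u to the patch of K. *)
have refined K : K \in T ->
    L2norm (hull K)° m G ^+ 2 <= (L5 * CT) ^+ 2 * \sum_(F <- patch_sides Om T K) a F.
  move=> KT; pose w := u \_ (patch_domain T K).
  have KP := mem_patch_of KT (sT _ KT).
  have uw x : (hull K)° x -> u x = w x.
    by move=> xK; rewrite /w patchE mem_set//; exact: interior_patch_domain KP _ xK.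
  have HmE : Hm_error m T K (J2 T u) u = rho_loc m (J2loc T K) T K w.
    apply: eq_L2norm => s x xK /=.
    rewrite (wderiv_ae s (J2_local _ _ _ TT_T KT u_V)).
    rewrite !fctE -sqrrN opprB (Dnc_local T s _ uw)//; exact: open_interior.
  have rho_le : rho_loc m (J2loc T K) T K w <= CT * mu_loc Om nu m T K u.
    rewrite -(mu_loc_patch K m u (tri _ TT_T) nuT).
    by apply: CT_bound => //; exists u.
  have G_le : L2norm (hull K)° m G <= L5 * Hm_error m T K (J2 T u) u.
    by rewrite /G uhat_def; exact: C5.
  have muE : mu_loc Om nu m T K u ^+ 2 = \sum_(F <- patch_sides Om T K) a F.
    by rewrite sqr_sqrtr//; apply: sumr_ge0 => F _; exact: a_ge0.
  apply: (@le_trans _ _ (L5 ^+ 2 * Hm_error m T K (J2 T u) u ^+ 2)).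
    by rewrite -exprMn lerXn2r ?nnegrE ?L2norm_ge0// (le_trans (L2norm_ge0 _ _ _) G_le).
  rewrite exprMn -[leRHS]mulrA ler_wpM2l ?sqr_ge0// -muE -exprMn HmE.
  by rewrite lerXn2r ?nnegrE ?L2norm_ge0// (le_trans (L2norm_ge0 _ _ _) rho_le).
pose M3 : R := max_patch_card TT.
have M3_ge0 : 0 <= M3 by apply: sup_ge0 => _ [T' [K [_ _ ->]]]; exact: ler0n.
pose B L := diam (hull L) * \sum_(F <- sides L) tangential_jump_norm m T F (nu F) u ^+ 2.
have B_ge0 L : 0 <= B L.
  by rewrite mulr_ge0 ?diam_ge0// sumr_ge0// => F _; exact: sqr_ge0.
have patch_le K : \sum_(F <- patch_sides Om T K) a F <= \sum_(L <- patch_of T K) B L.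
  apply: (le_trans (sum_patch_sides_le _ _ _ a_ge0)); apply: ler_sum => L _.
  rewrite /B mulr_sumr big_seq [leRHS]big_seq; apply: ler_sum => F FL.
  by rewrite ler_wpM2r ?sqr_ge0// diam_side.
have -> : (L5 * CT * Num.sqrt (max_patch_card TT)) ^+ 2 = (L5 * CT) ^+ 2 * M3.
  by rewrite [LHS]exprMn (sqr_sqrtr M3_ge0).
rewrite -[leRHS]mulrA -/(B _).
rewrite sqr_L2norm.
apply: (@le_trans _ _ (\sum_(K <- T) L2norm (hull K)° m G ^+ 2)).
  under eq_bigr do rewrite sqr_L2norm.
  have Dmb s := Dnc_measurable_bounded s e_poly.
  apply: integral_mesh_interior_le.
  - by apply: open_measurable_rV; case: dom_Om.
  - by move=> K _; exact: hull_bounded.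
  - apply: measurable_sum => t; apply: measurable_funX; exact: (Dmb _).1.
  - by move=> x; apply: sumr_ge0 => t _; exact: sqr_ge0.
  - have [N hN] := choice (fun t : m.-tuple 'I_n.+1 => (Dmb t).2).
    exists (\sum_t N t ^+ 2) => x; apply: ler_sum => t _.
    by rewrite -real_normK ?num_real// lerXn2r ?nnegrE// (le_trans _ (hN t x)).
  - move=> x xT; apply: big1 => t _; rewrite /G /Dnc patchE memNset ?expr0n//.
    by move=> /(refines_interior ref).
apply: (@le_trans _ _ (\sum_(K <- T | K \notin That)
    (L5 * CT) ^+ 2 * \sum_(L <- patch_of T K) B L)).
  rewrite [leRHS]big_mkcond big_seq [leRHS]big_seq/=; apply: ler_sum => K KT.
  case: ifPn => [_|]; last by rewrite negbK => /(kept _ KT) ->.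
  by rewrite (le_trans (refined _ KT))// ler_wpM2l ?sqr_ge0.
rewrite -mulr_sumr ler_wpM2l ?sqr_ge0//; apply: sum_patches_le => // K KT.
exact: card_patch_le_max tri A2 TT_T KT.
Qed.
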